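(* Let $N\ge1$, $D>0$, $\kappa>0$, $q\in[0,1]$, and $L(\delta)=\kappa/\delta^q$. For any convex $L(\cdot)$-inexactly smooth function $f$ with minimizer $x_\star$ satisfying $\|x_0-x_\star\|\le D$, the Inexactly Smooth Optimized Gradient Method (given in the context) with tolerances $$\delta_{n-1,n}=\left(\frac{q\kappa D^2}{(q+1)^2(N+1)}\right)^{\frac1{q+1}}n^{-\frac{2}{q+1}}\quad(n=1,\dots,N),\qquad\delta_{\star,n}=0\quad(n=0,\dots,N),$$ is guaranteed to have $$f(x_N)-f(x_\star)\le\frac{\frac12D^2+\sigma_N}{\tau_N}\le\left(\frac{(q+1)^{\frac{q-1}{q+1}}}{q^{\frac q{q+1}}}+o(1)\right)\frac{\kappa^{\frac1{q+1}}D^{\frac2{q+1}}}{(N+1)^{\frac{2-q}{q+1}}},$$ where $\sigma_N=\sum_{i=1}^N\tau_{i-1}\delta_{i-1,i}$. In particular, if $f$ is convex and $(\beta,p)$-Hölder smooth, with $\beta>0$, $p\in[0,1]$, and has a minimizer $x_\star$ with $\|x_0-x_\star\|\le D$, then the Inexactly Smooth Optimized Gradient Method with suitable choices of the tolerances $\delta$ (and run with $L(\delta)=\kappa/\delta^q$, where now $q=\frac{1-p}{1+p}$ and $\kappa=(q/2)^q\beta^{\frac{2}{1+p}}$) has $$f(x_N)-f(x_\star)\le\left(\frac{(p+1)^p}{2^{\frac{p+1}2}}+o(1)\right)\frac{\beta D^{1+p}}{(N+1)^{\frac{1+3p}2}}.$$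
   Context: Here $o(1)$ denotes a quantity tending to $0$ as $N\to\infty$ with the other parameters ($\kappa,q,D$, resp. $\beta,p,D$) fixed, not depending on $f$, $x_0$ or $d$. Conventions: $1/\infty=0$, $1/0=\infty$, $0^0=1$ (so $L\equiv\kappa$ if $q=0$, while $L(0)=\infty$ and $1/L(0)=0$ if $q>0$). Norms are Euclidean. A convex $f:\mathbb{R}^d\to(-\infty,\infty]$ (closed, proper) is $L(\cdot)$-inexactly smooth if $f(y)\le f(x)+\langle g_x,y-x\rangle+\frac{L(\delta)}2\|y-x\|^2+\delta$ for all $x,y\in\mathbb{R}^d$, $g_x\in\partial f(x)$, $\delta\ge0$ (nothing is imposed when $L(\delta)=\infty$). It is $(\beta,p)$-Hölder smooth if $\|g_x-g_y\|\le\beta\|x-y\|^p$ for all $x,y$, $g_x\in\partial f(x)$, $g_y\in\partial f(y)$. Inexactly Smooth Optimized Gradient Method. Input: $x_0$, iteration budget $N$, tolerances $\{\delta_{n-1,n}\}_{n=1}^N$, $\{\delta_{\star,n}\}_{n=0}^N$. At each point, $g_n\in\partial f(x_n)$ is any subgradient. Initialize $\tau_0=\frac1{L(\delta_{0,1})}+\frac1{L(\delta_{\star,0})}$ and $z_1=x_0-\tau_0g_0$. For $n=1,\dots,N$: $$\rho_n=\begin{cases}\sqrt{\frac1{L(\delta_{\star,n})^2}+\frac{4\tau_{n-1}}{L(\delta_{n-1,n})}}&n=N,\\[1ex]\frac1{L(\delta_{n,n+1})}+\sqrt{\Big(\frac1{L(\delta_{n,n+1})}+\frac1{L(\delta_{\star,n})}\Big)^2+\frac{4\tau_{n-1}}{L(\delta_{n-1,n})}+\frac{4\tau_{n-1}}{L(\delta_{n,n+1})}}&n<N,\end{cases}$$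 $$\tau_n=\tau_{n-1}+\frac1{2L(\delta_{\star,n})}+\frac{\rho_n}2,\qquad x_n=\frac{\tau_{n-1}}{\tau_n}\Big(x_{n-1}-\frac1{L(\delta_{n-1,n})}g_{n-1}\Big)+\frac{\tau_n-\tau_{n-1}}{\tau_n}z_n,$$ $$z_{n+1}=z_n-(\tau_n-\tau_{n-1})g_n.$$ *)

(* Defs.v *)
From mathcomp Require Import all_boot all_order all_algebra.
From mathcomp Require Import all_classical all_reals all_analysis.
Import Order.TTheory GRing.Theory Num.Theory.
Import numFieldNormedType.Exports.

Set Implicit Arguments.
Unset Strict Implicit.
Unset Printing Implicit Defensive.

Local Open Scope classical_set_scope.
Local Open Scope ring_scope.

Section Euclidean.
Variables (R : realType) (d : nat).
Implicit Types u v : 'rV[R]_d.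

Definition dot u v : R := \sum_(i < d) u 0 i * v 0 i.

(* The library norm `|u| on 'rV[R]_d is the sup norm. *)
Definition norm2 u : R := Num.sqrt (dot u u).

End Euclidean.

Section ConvexFunctions.
Variables (R : realType) (d : nat).
Implicit Types (f : 'rV[R]_d -> \bar R) (x g : 'rV[R]_d).

Definition proper f : Prop :=
  (forall x, f x != -oo%E) /\ (exists x, f x \is a fin_num).

(* At t = 0 or t = 1 the convention 0 * +oo = 0 of \bar R is used. *)
Definition convex_efun f : Prop :=
  forall (x y : 'rV[R]_d) (t : R), 0 <= t <= 1 ->
    (f (t *: x + (1 - t) *: y)%R <= t%:E * f x + (1 - t)%:E * f y)%E.

Definition closed_proper_convex f : Prop :=
  [/\ proper f, lower_semicontinuous f & convex_efun f].

(* For proper f this set is empty wherever f x = +oo. *)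
Definition subdifferential f x : set 'rV[R]_d :=
  [set g | forall y : 'rV[R]_d, (f x + (dot g (y - x))%:E <= f y)%E].

Definition minimizer f x : Prop := forall y, (f x <= f y)%E.

Definition inexactly_smooth (L : R -> \bar R) f : Prop :=
  forall x y g (delta : R), subdifferential f x g -> 0 <= delta ->
    L delta != +oo%E ->
    (f y <= f x + (dot g (y - x))%:E
            + L delta / 2%:E * (norm2 (y - x) ^+ 2)%:E + delta%:E)%E.

(* powR satisfies 0 `^ 0 = 1. *)
Definition holder_smooth (beta p : R) f : Prop :=
  forall x y gx gy, subdifferential f x gx -> subdifferential f y gy ->
    norm2 (gx - gy) <= beta * norm2 (x - y) `^ p.

End ConvexFunctions.

Section Method.
Variable R : realType.

(* kappa / delta ^ q; the inverse of \bar R satisfies 0^-1 = +oo and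
   +oo^-1 = 0, so this is +oo at delta = 0 when q > 0, and is constantly kappa
   when q = 0. *)
Definition powerL (kappa q delta : R) : \bar R :=
  (kappa%:E / (delta `^ q)%:E)%E.

(* The tolerances are sequences: dl n stands for delta_{n-1,n} (1 <= n <= N)
   and ds n for delta_{*,n} (0 <= n <= N); other values are never used. *)
Variables (L : R -> \bar R) (dl ds : nat -> R) (N : nat).

(* 1 / L delta, read back as a real number; it is finite when L delta > 0. *)
Definition invL (delta : R) : R := fine ((L delta)^-1)%E.

(* t is tau_{n-1}. *)
Definition rho_of (n : nat) (t : R) : R :=
  if n == N then
    Num.sqrt (invL (ds n) ^+ 2 + 4 * t * invL (dl n))
  else
    invL (dl n.+1)
    + Num.sqrt ((invL (dl n.+1) + invL (ds n)) ^+ 2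
                + 4 * t * invL (dl n) + 4 * t * invL (dl n.+1)).

Fixpoint tau (n : nat) : R :=
  if n is m.+1 then
    tau m + invL (ds m.+1) / 2 + rho_of m.+1 (tau m) / 2
  else invL (dl 1%N) + invL (ds 0%N).

Definition sigma : R := \sum_(1 <= i < N.+1) tau i.-1 * dl i.

(* x, z, g are the iterates of some execution on f from x0, the subgradients g
   being arbitrary; z is used at the indices 1, ..., N + 1. *)
Definition isogm_run (d : nat) (f : 'rV[R]_d -> \bar R) (x0 : 'rV[R]_d)
    (x z g : nat -> 'rV[R]_d) : Prop :=
  [/\ x 0%N = x0,
      z 1%N = x0 - tau 0%N *: g 0%N,
      forall n, (n <= N)%N -> subdifferential f (x n) (g n) &
      forall n, (1 <= n <= N)%N ->
        x n = (tau n.-1 / tau n) *: (x n.-1 - invL (dl n) *: g n.-1)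
              + ((tau n - tau n.-1) / tau n) *: z n
        /\ z n.+1 = z n - (tau n - tau n.-1) *: g n].

End Method.

Section Tolerances.
Variable R : realType.

Definition opt_tol (kappa q D : R) (N n : nat) : R :=
  (q * kappa * D ^+ 2 / ((q + 1) ^+ 2 * (N.+1)%:R)) `^ (1 / (q + 1))
  * n%:R `^ (- (2 / (q + 1))).

Definition zero_tol (n : nat) : R := 0.

End Tolerances.

Arguments zero_tol {R} n.

(* Main.v *)
(* The inequality defining inexact smoothness gives an inexact cocoercivity
   inequality between two iterates. Adding these inequalities for consecutive
   iterates with weights tau_(n-1), and the subgradient inequalities at the
   minimizer with weights tau_n - tau_(n-1), all the coefficients of the
   |g_n|^2 vanish because rho_n solves a quadratic equation; this is the bound
   (D^2/2 + sigma_N) / tau_N.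

   With b = 1/(q+1), the quadratic equation says that sqrt tau_n increases by
   sqrt (l_n / 2) up to lower order terms, where l_n = 1/L(delta_(n-1,n)) is
   a n^(2(b-1)) with a depending on N only. Hence tau_n ~ a n^(2b) / (2 b^2),
   and Cesaro's lemma yields the limit of sigma_N.

   For a Hoelder smooth f, the proximal points of y carry bounded subgradients,
   a cluster point of which is a subgradient at y. So f is finite everywhere and
   subdifferentiable, and summing subgradient inequalities along a fine
   subdivision of a segment gives
   f y <= f x + <g, y - x> + beta/(1+p) |y - x|^(1+p);
   weighted AM-GM turns this into inexact smoothness. *)

Require Import Defs.
From mathcomp Require Import all_boot all_order all_algebra.
From mathcomp Require Import all_classical all_reals all_analysis.
From mathcomp Require Import ring lra.
Import Order.TTheory GRing.Theory Num.Theory.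
Import numFieldNormedType.Exports.

Local Open Scope classical_set_scope.
Local Open Scope ring_scope.

(** * The convergence bound *)

Section Dot.
Context {R : realType} {d : nat}.
Implicit Types u v w : 'rV[R]_d.

Lemma dotC u v : dot u v = dot v u.
Proof. by apply: eq_bigr => i _; rewrite mulrC. Qed.

Lemma dotDl u v w : dot (u + v) w = dot u w + dot v w.
Proof. by rewrite /dot -big_split; apply: eq_bigr => i _; rewrite mxE mulrDl. Qed.

Lemma dotZl a u v : dot (a *: u) v = a * dot u v.
Proof. by rewrite /dot mulr_sumr; apply: eq_bigr => i _; rewrite mxE mulrA. Qed.

Lemma dotNl u v : dot (- u) v = - dot u v.
Proof. by rewrite -scaleN1r dotZl mulN1r. Qed.

Lemma dotDr u v w : dot u (v + w) = dot u v + dot u w.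
Proof. by rewrite dotC dotDl !(dotC u). Qed.

Lemma dotZr a u v : dot u (a *: v) = a * dot u v.
Proof. by rewrite dotC dotZl dotC. Qed.

Lemma dotNr u v : dot u (- v) = - dot u v.
Proof. by rewrite dotC dotNl dotC. Qed.

Definition dotE := (dotDl, dotDr, dotNl, dotNr, dotZl, dotZr).

Lemma dot0l u : dot 0 u = 0.
Proof. by rewrite -(scale0r 0) dotZl mul0r. Qed.

Lemma dotvv_ge0 u : 0 <= dot u u.
Proof. by apply: sumr_ge0 => i _; rewrite -expr2 sqr_ge0. Qed.

Lemma norm2_ge0 u : 0 <= norm2 u.
Proof. exact: sqrtr_ge0. Qed.

Lemma norm2_sqr u : norm2 u ^+ 2 = dot u u.
Proof. by rewrite sqr_sqrtr // dotvv_ge0. Qed.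

Lemma norm2Z a u : norm2 (a *: u) = `|a| * norm2 u.
Proof. by rewrite /norm2 dotZl dotZr mulrA -expr2 sqrtrM ?sqr_ge0// sqrtr_sqr. Qed.

Lemma norm2N u : norm2 (- u) = norm2 u.
Proof. by rewrite -scaleN1r norm2Z normrN1 mul1r. Qed.

Lemma Cauchy_Schwarz u v : dot u v <= norm2 u * norm2 v.
Proof.
have [u0|u0] := eqVneq (dot u u) 0.
  have -> : dot u v = 0.
    rewrite /dot big1// => i _.
    move/eqP: u0; rewrite psumr_eq0 => [/allP/(_ i)|j _]; last by rewrite -expr2 sqr_ge0.
    by rewrite mem_index_enum -expr2 sqrf_eq0 => /(_ isT) /eqP ->; rewrite mul0r.
  by rewrite mulr_ge0// norm2_ge0.
have uu : 0 < dot u u by rewrite lt_neqAle eq_sym u0 dotvv_ge0.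
apply: le_trans (ler_norm _) _.
rewrite -ler_sqr ?nnegrE ?normr_ge0 ?mulr_ge0 ?norm2_ge0//.
rewrite real_normK ?num_real// exprMn !norm2_sqr.
(* The squared length is [dot u u] times |u|^2 |v|^2 - <u, v>^2, and [dot u u] is positive here. *)
have := dotvv_ge0 (dot u u *: v - dot u v *: u).
rewrite !dotE (dotC v u) => h.
rewrite -(ler_pM2l uu).
nra.
Qed.

End Dot.

Section Subgradients.
Context {R : realType} {d : nat} (f : 'rV[R]_d -> \bar R).
Hypothesis f_proper : Defs.proper f.

(** If f were infinite at [x], the subgradient inequality would make it infinite at every point,
    against properness. *)
Lemma subdifferential_fin_num x g : subdifferential f x g -> f x \is a fin_num.
Proof.
have [fN [y fy]] := f_proper => /(_ y).
rewrite fin_numE fN /=; case: (f x) (fN x) => //= _.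
by rewrite addye// leye_eq => /eqP fyE; rewrite fyE in fy.
Qed.

Lemma minimizer_fin_num x : minimizer f x -> f x \is a fin_num.
Proof.
have [fN [y fy]] := f_proper => /(_ y).
rewrite fin_numE fN /=; case: (f x) (fN x) => //= _.
by rewrite leye_eq => /eqP fyE; rewrite fyE in fy.
Qed.

Lemma minimizer_subdifferential x : minimizer f x -> subdifferential f x 0.
Proof. by move=> fx y; rewrite dot0l adde0. Qed.

Lemma subdifferential_fine x y gx gy :
  subdifferential f x gx -> subdifferential f y gy ->
  fine (f x) + dot gx (y - x) <= fine (f y).
Proof.
move=> fx fy; have := fx y.
rewrite -{1}(fineK (subdifferential_fin_num _ _ fx)).
by rewrite -{1}(fineK (subdifferential_fin_num _ _ fy)) -EFinD lee_fin.
Qed.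

(* The smoothness bound at [x] and the subgradient bound at [y] are compared
   at the point [x - (gx - gy) / L delta]. *)
Lemma inexact_cocoercivity (L : R -> \bar R) (delta : R) x y gx gy :
  inexactly_smooth L f -> 0 <= delta -> (0 < L delta)%E ->
  subdifferential f x gx -> subdifferential f y gy ->
  fine (f y) + dot gy (x - y)
    + invL L delta / 2 * dot (gx - gy) (gx - gy) - delta <= fine (f x).
Proof.
move=> Lf delta0 L0 fx fy.
(* Where L is infinite its inverse reads 0, and the subgradient inequality suffices. *)
have [Ly|Ly] := eqVneq (L delta) +oo%E.
  rewrite /invL Ly /= mul0r mul0r addr0.
  by apply: le_trans (subdifferential_fine _ _ _ _ fy fx); rewrite gerBl.
have [K LK] : exists K, L delta = K%:E by case: (L delta) Ly L0 => // r; exists r.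
have K0 : 0 < K by rewrite -lte_fin -LK.
have -> : invL L delta = K^-1 by rewrite /invL LK inver gt_eqF.
set w := x - K^-1 *: (gx - gy).
have := Lf x w gx delta fx delta0 Ly.
rewrite LK inver pnatr_eq0 /= -EFinM -{1}(fineK (subdifferential_fin_num _ _ fx)).
rewrite -!EFinD => /(le_trans (fy w)).
rewrite -{1}(fineK (subdifferential_fin_num _ _ fy)) -!EFinD lee_fin norm2_sqr.
rewrite /w.
have -> : x - K^-1 *: (gx - gy) - x = - (K^-1 *: (gx - gy)).
  by rewrite addrAC subrr add0r.
have -> : x - K^-1 *: (gx - gy) - y = (x - y) - K^-1 *: (gx - gy).
  by rewrite addrAC.
rewrite !dotE !(dotC gy gx).
set A := dot gy x; set B := dot gy y; set C := dot gx gx; set E := dot gx gy.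
set F := dot gy gy; set fx' := fine _; set fy' := fine _.
set k := K^-1 => h.
have kK : K * k = 1 by rewrite mulfV// gt_eqF.
have h2 : K / 2 * - - (k * (k * (C - E - (E - F)))) = k / 2 * (C - E - (E - F)).
  by rewrite !opprK; transitivity (K * k * (k / 2 * (C - E - (E - F)))); [ring|rewrite kK mul1r].
lra.
Qed.

End Subgradients.

Section StepSizes.
Context {R : realType} (L : R -> \bar R) (dl : nat -> R) (N : nat).
Hypothesis L_gt0 : forall delta, 0 <= delta -> (0 < L delta)%E.
Hypothesis dl_ge0 : forall n, 0 <= dl n.
Hypothesis tau0_gt0 : 0 < tau L dl zero_tol N 0.

Local Notation t := (tau L dl zero_tol N).
Local Notation l n := (invL L (dl n)).
Local Notation s := (invL L 0).

Lemma invL_ge0 delta : 0 <= delta -> 0 <= invL L delta.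
Proof. by move=> d0; rewrite fine_ge0// inve_ge0 ltW// L_gt0. Qed.

Lemma rho_ge0 n : 0 <= t n -> 0 <= rho_of L dl zero_tol N n.+1 (t n).
Proof.
move=> tn; rewrite /rho_of; case: ifP => _; first exact: sqrtr_ge0.
by rewrite addr_ge0 ?sqrtr_ge0// invL_ge0.
Qed.

Lemma tau_step_ge0 n : 0 <= t n -> t n <= t n.+1.
Proof.
move=> tn /=; rewrite -addrA lerDl addr_ge0 ?divr_ge0 ?rho_ge0//.
exact: invL_ge0.
Qed.

Lemma tau_gt0 n : 0 < t n.
Proof. by elim: n => // n IH; rewrite (lt_le_trans IH)// tau_step_ge0// ltW. Qed.

Lemma tau_le n : t n <= t n.+1.
Proof. by rewrite tau_step_ge0// ltW// tau_gt0. Qed.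

(** The increment of tau is a root of X^2 = X (s + l_(n+2)) + tau_n (l_(n+1) + l_(n+2)). Regrouping
    isolates [t n.+1 * l n.+2], the term handed on to the next step of the potential. *)
Lemma tau_quadratic n : (n.+1 < N)%N ->
  (t n.+1 - t n) ^+ 2 = (t n.+1 - t n) * s + t n.+1 * l n.+2 + t n * l n.+1.
Proof.
move=> nN; rewrite /= /rho_of ltn_eqF// /zero_tol.
have tn := ltW (tau_gt0 n).
have l1 : 0 <= l n.+1 by rewrite invL_ge0.
have l2 : 0 <= l n.+2 by rewrite invL_ge0.
have s0 : 0 <= s by rewrite invL_ge0.
set u := Num.sqrt _.
have : u ^+ 2 = (l n.+2 + s) ^+ 2 + 4 * t n * l n.+1 + 4 * t n * l n.+2.
  rewrite sqr_sqrtr//.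
  have := mulr_ge0 tn l1; have := mulr_ge0 tn l2; have := sqr_ge0 (l n.+2 + s).
  by lra.
nra.
Qed.

Lemma tau_quadratic_last n : n.+1 = N ->
  (t n.+1 - t n) ^+ 2 = (t n.+1 - t n) * s + t n * l n.+1.
Proof.
move=> nN; rewrite /= /rho_of nN eqxx /zero_tol.
have tn := ltW (tau_gt0 n).
have l1 : 0 <= l N by rewrite invL_ge0.
have s0 : 0 <= s by rewrite invL_ge0.
set u := Num.sqrt _.
have : u ^+ 2 = s ^+ 2 + 4 * t n * l N.
  by rewrite sqr_sqrtr//; have := mulr_ge0 tn l1; have := sqr_ge0 s; lra.
nra.
Qed.

Section Convergence.
Context {d : nat} (f : 'rV[R]_d -> \bar R) (x0 xs : 'rV[R]_d).
Context (x z g : nat -> 'rV[R]_d).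
Hypothesis f_proper : Defs.proper f.
Hypothesis f_smooth : inexactly_smooth L f.
Hypothesis xs_min : minimizer f xs.
Hypothesis run : isogm_run L dl zero_tol N f x0 x z g.

Local Notation F n := (fine (f (x n))).
Local Notation fs := (fine (f xs)).

(** Inexact cocoercivity at the minimizer, with subgradient 0 and tolerance 0. *)
Lemma isogm_star_ineq n : (n <= N)%N ->
  F n + dot (g n) (xs - x n) + s / 2 * dot (g n) (g n) <= fs.
Proof.
move=> nN; case: run => _ _ /(_ n nN) gn _.
have := inexact_cocoercivity f f_proper L 0 xs (x n) 0 (g n) f_smooth
  (lexx _) (L_gt0 0 (lexx _)) (minimizer_subdifferential f xs xs_min) gn.
by rewrite sub0r !dotE opprK subr0.
Qed.

Lemma isogm_consecutive_ineq n : (n < N)%N ->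
  F n.+1 + dot (g n.+1) (x n - x n.+1)
    + l n.+1 / 2 * dot (g n - g n.+1) (g n - g n.+1) - dl n.+1 <= F n.
Proof.
move=> nN; case: run => _ _ gP _; have gn := gP n (ltnW nN).
have gSn := gP n.+1 nN.
exact: (inexact_cocoercivity f f_proper L _ _ _ _ _ f_smooth (dl_ge0 _)
  (L_gt0 _ (dl_ge0 _)) gn gSn).
Qed.

Definition half_dist n : R := dot (z n.+1 - xs) (z n.+1 - xs) / 2.

Let partial_sigma n : R := \sum_(1 <= i < n.+1) t i.-1 * dl i.

(* [c] is the coefficient of [|g_n.+1|^2 / 2] left over by the weighted
   inequalities of step [n.+1]. *)
Lemma isogm_step n c : (n < N)%N ->
  (t n.+1 - t n) ^+ 2 = (t n.+1 - t n) * s + c + t n * l n.+1 ->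
  t n.+1 * (F n.+1 - fs) + half_dist n.+1 - c / 2 * dot (g n.+1) (g n.+1)
  <= t n * (F n - fs) + half_dist n - t n * l n.+1 / 2 * dot (g n) (g n)
     + t n * dl n.+1.
Proof.
move=> nN quad.
have Sn0 : t n.+1 != 0 by rewrite gt_eqF// tau_gt0.
have [xE zE] : x n.+1 = (t n / t n.+1) *: (x n - l n.+1 *: g n)
              + ((t n.+1 - t n) / t n.+1) *: z n.+1
        /\ z n.+2 = z n.+1 - (t n.+1 - t n) *: g n.+1.
  by case: run => _ _ _ /(_ n.+1 nN).
have A := isogm_star_ineq n.+1 nN.
have B := isogm_consecutive_ineq n nN.
have {}A : (t n.+1 - t n) * (F n.+1 + dot (g n.+1) (xs - x n.+1)
   + s / 2 * dot (g n.+1) (g n.+1)) <= (t n.+1 - t n) * fs.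
  by rewrite ler_wpM2l// subr_ge0 tau_le.
have {}B : t n * (F n.+1 + dot (g n.+1) (x n - x n.+1)
    + l n.+1 / 2 * dot (g n - g n.+1) (g n - g n.+1) - dl n.+1) <= t n * F n.
  by rewrite ler_wpM2l// ltW// tau_gt0.
(* The definition of x_(n+1), cleared of its denominator, removes the iterates from the inner
   products with g_(n+1). *)
have xg : t n.+1 * dot (g n.+1) (x n.+1) = t n * dot (g n.+1) (x n)
   - t n * l n.+1 * dot (g n) (g n.+1)
   + (t n.+1 - t n) * dot (g n.+1) (z n.+1).
  rewrite {1}xE !dotE (dotC (g n)); move: (t n) (t n.+1) Sn0 => a b b0.
  by field.
rewrite /half_dist zE.
have -> : z n.+1 - (t n.+1 - t n) *: g n.+1 - xs
    = (z n.+1 - xs) - (t n.+1 - t n) *: g n.+1 by rewrite addrAC.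
move: A B xg; rewrite !dotE (dotC xs (g n.+1)) (dotC xs (z n.+1))
  (dotC (z n.+1) (g n.+1)) (dotC (g n.+1) (g n)).
move: (t n) (t n.+1) (dl n.+1) (l n.+1) s quad => a b e k r quad A B xg.
set GG := dot (g n.+1) (g n.+1) in A B xg *.
(* The square comes from expanding |z_(n+2) - xs|^2; the quadratic equation replaces it by the
   coefficients of the two inequalities and [c]. *)
have : (b - a) ^+ 2 * GG = ((b - a) * r + c + a * k) * GG by rewrite quad.
lra.
Qed.

(** Induction along [isogm_step] with [c = t n.+1 * l n.+2]: what a step leaves over is exactly the
    negative gradient term of the next potential. *)
Lemma isogm_potential n : (n < N)%N ->
  t n * (F n - fs) + half_dist n - t n * l n.+1 / 2 * dot (g n) (g n)
  <= norm2 (x0 - xs) ^+ 2 / 2 + partial_sigma n.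
Proof.
elim: n => [|n IH] nN.
  have := isogm_star_ineq 0%N isT.
  rewrite /partial_sigma big_geq// addr0 norm2_sqr /half_dist.
  case: run => -> z1 _ _; rewrite z1.
  have -> : x0 - t 0%N *: g 0%N - xs = (x0 - xs) - t 0%N *: g 0%N by rewrite addrAC.
  (* Weighting by [t 0] leaves half of tau_0^2 - tau_0 (l_1 + s) in front of |g_0|^2, which is 0. *)
  have tE : t 0%N = l 1%N + s by [].
  have t0 := ltW tau0_gt0.
  move=> /(ler_wpM2l t0).
  rewrite !dotE (dotC xs x0) (dotC xs (g 0%N)) (dotC x0 (g 0%N)).
  move: (t 0%N) tE t0 => a tE t0.
  set GG := dot (g 0%N) (g 0%N).
  have : a * a * GG = a * (l 1%N + s) * GG by rewrite -tE.
  lra.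
apply: le_trans (_ : _ <= t n * (F n - fs) + half_dist n
     - t n * l n.+1 / 2 * dot (g n) (g n) + t n * dl n.+1) _.
  apply: isogm_step; first exact: ltnW.
  exact: tau_quadratic.
by rewrite /partial_sigma big_nat_recr//= addrA lerD2r IH// ltnW.
Qed.

Lemma isogm_rate : (1 <= N)%N ->
  F N - fs <= (norm2 (x0 - xs) ^+ 2 / 2 + sigma L dl zero_tol N) / t N.
Proof.
move=> N_gt0; have nN : N.-1.+1 = N by rewrite prednK.
have ltN : (N.-1 < N)%N by rewrite nN.
rewrite ler_pdivlMr ?tau_gt0// mulrC.
(* The last step size carries no gradient term over, hence [c = 0]. *)
have := isogm_step N.-1 0 ltN; rewrite addr0 => /(_ (tau_quadratic_last _ nN)).
have := isogm_potential N.-1 ltN; rewrite /partial_sigma nN.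
have : 0 <= half_dist N by rewrite /half_dist divr_ge0// dotvv_ge0.
rewrite /sigma [in X in _ -> _ -> _ -> X]big_nat_recr//=.
lra.
Qed.

End Convergence.
End StepSizes.

(** * Power functions *)

Section PowerInequalities.
Context {R : realType}.
Implicit Types x y b p : R.

(** Young's inequality for the conjugate exponents 1/b and 1/(1-b); the endpoints, where one of them
    is infinite, are treated apart. *)
Lemma powR_amgm x y b : 0 <= x -> 0 <= y -> 0 <= b <= 1 ->
  x `^ b * y `^ (1 - b) <= b * x + (1 - b) * y.
Proof.
move=> x0 y0 /andP[b0 b1].
have [->|bn0] := eqVneq b 0; first by rewrite powRr0 subr0 powRr1// !mul1r mul0r add0r.
have [->|bn1] := eqVneq b 1; first by rewrite subrr powRr0 powRr1// mul1r mul0r addr0 mulr1.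
have bgt0 : 0 < b by rewrite lt_def bn0.
have b1gt0 : 0 < 1 - b by rewrite subr_gt0 lt_neqAle bn1.
have := @conjugate_powR R (x `^ b) (y `^ (1 - b)) b^-1 (1 - b)^-1
  (powR_ge0 _ _) (powR_ge0 _ _).
rewrite !invr_gt0 !invrK => /(_ bgt0 b1gt0 (subrKC _ _)).
by rewrite -!powRrM !divff ?gt_eqF// !powRr1// !(mulrC _ b) (mulrC y).
Qed.

Lemma powR_Bernoulli_le x b : -1 <= x -> 0 <= b <= 1 -> (1 + x) `^ b <= 1 + b * x.
Proof.
move=> x1 b01; have := @powR_amgm (1 + x) 1 b _ ler01 b01.
by rewrite powR1 mulr1 -lerBlDl sub0r => /(_ x1) h; apply: le_trans h _; lra.
Qed.

(** The concave case with exponent 1/p at [p * x], raised to the power [p]. *)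
Lemma powR_Bernoulli_ge x p : 0 <= x -> 1 <= p -> 1 + p * x <= (1 + x) `^ p.
Proof.
move=> x0 p1; have p0 : 0 < p by lra.
have px0 : 0 <= p * x by rewrite mulr_ge0// ltW.
have := @powR_Bernoulli_le (p * x) p^-1.
rewrite invr_ge0 (ltW p0) invf_le1// p1 mulKf ?gt_eqF// => /(_ _ isT).
have px1 : -1 <= p * x by lra.
move=> /(_ px1) /(ge0_ler_powR (ltW p0)).
rewrite -powRrM mulVf ?gt_eqF// powRr1; last lra.
by apply; rewrite nnegrE ?powR_ge0//; lra.
Qed.

Lemma powR_pred x b : 0 < x -> x `^ (b - 1) = x `^ b / x.
Proof. by move=> x0; rewrite powRB ?powRr1 ?ltW// (gt_eqF x0) implybT. Qed.

(** Bernoulli at y/x - 1, scaled by x^b. *)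
Lemma powR_tangent x y b : 0 < x -> 0 <= y -> 0 <= b <= 1 ->
  y `^ b <= x `^ b + b * x `^ (b - 1) * (y - x).
Proof.
move=> x0 y0 b01; have := @powR_Bernoulli_le (y / x - 1) b.
have yx0 : 0 <= y / x by rewrite divr_ge0// ltW.
have yx1 : -1 <= y / x - 1 by lra.
move=> /(_ yx1 b01); rewrite subrKC => h.
have -> : y `^ b = x `^ b * (y / x) `^ b.
  by rewrite -(powRM b (ltW x0) yx0); congr (_ `^ _); field; rewrite gt_eqF.
apply: le_trans (ler_wpM2l (powR_ge0 x b) h) _.
rewrite powR_pred//.
have -> : b * (x `^ b / x) * (y - x) = x `^ b * (b * (y / x - 1)).
  by field; rewrite gt_eqF.
by rewrite mulrDr mulr1.
Qed.

Lemma powR_tangent_ge x y p : 0 < x -> x <= y -> 1 <= p ->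
  x `^ p + p * x `^ (p - 1) * (y - x) <= y `^ p.
Proof.
move=> x0 xy p1; have := @powR_Bernoulli_ge (y / x - 1) p.
rewrite subr_ge0 ler_pdivlMr// mul1r => /(_ xy p1); rewrite subrKC => h.
have -> : y `^ p = x `^ p * (y / x) `^ p.
  have yx0 : 0 <= y / x by rewrite divr_ge0 ?(le_trans _ xy)// ltW.
  by rewrite -(powRM p (ltW x0) yx0); congr (_ `^ _); field; rewrite gt_eqF.
apply: le_trans (ler_wpM2l (powR_ge0 x p) h).
rewrite powR_pred//.
have -> : p * (x `^ p / x) * (y - x) = x `^ p * (p * (y / x - 1)).
  by field; rewrite gt_eqF.
by rewrite [in leRHS]mulrDr mulr1.
Qed.

Lemma powR_natS_cvg0 b : 0 < b -> n.+1%:R `^ (- b) @[n --> \oo] --> (0 : R).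
Proof.
move=> b0.
have -> : (fun n => n.+1%:R `^ (- b)) = (fun n => @harmonic R n `^ b).
  by apply/funext => n; rewrite /harmonic /= -powR_inv1// -powRrM mulN1r.
apply: cvg_comp (powR_cvg0 b0) => A [e /= e0 eA].
have /cvgrPdist_lt /(_ e e0) := @cvg_harmonic R.
apply: filterS => n /= hn; exact: eA.
Qed.

End PowerInequalities.

(** * Asymptotics of the step sizes *)

Section TauGrowth.
Context {R : realType} (L : R -> \bar R) (dl : nat -> R) (N : nat) (a b : R).
Hypothesis L_gt0 : forall delta, 0 <= delta -> (0 < L delta)%E.
Hypothesis dl_ge0 : forall n, 0 <= dl n.
Hypothesis a_gt0 : 0 < a.
Hypothesis b_bnd : 0 < b <= 1.
Hypothesis invL_dl : forall n, invL L (dl n.+1) = a * (n.+1%:R `^ (b - 1)) ^+ 2.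

Local Notation t := (tau L dl zero_tol N).
Local Notation l n := (invL L (dl n)).
Local Notation s := (invL L 0).
Local Notation r2 := (Num.sqrt 2 : R).

Let b01 : 0 <= b <= 1. Proof. by case/andP: b_bnd => /ltW ->. Qed.

Let r2_gt0 : 0 < r2. Proof. by rewrite sqrtr_gt0 ltr0n. Qed.

Let r2_sqr : r2 ^+ 2 = 2. Proof. by rewrite sqr_sqrtr// ler0n. Qed.

Lemma tau0E : t 0%N = a + s.
Proof. by rewrite /= invL_dl powR1 expr1n mulr1. Qed.

Let tau0_gt0 : 0 < t 0%N.
Proof. by rewrite tau0E ltr_wpDr// invL_ge0. Qed.

Let tpos := tau_gt0 L dl N L_gt0 dl_ge0 tau0_gt0.
Let tle := tau_le L dl N L_gt0 dl_ge0 tau0_gt0.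

Lemma invL_dl_nonincreasing n : l n.+2 <= l n.+1.
Proof.
rewrite !invL_dl ler_pM2l// ler_sqr ?nnegrE ?powR_ge0//.
rewrite -(opprB 1 b) !powRN lef_pV2 ?posrE ?powR_gt0//.
rewrite ge0_ler_powR ?nnegrE// ?ler_nat//.
by rewrite subr_ge0; case/andP: b_bnd.
Qed.

(** With u, v the two square roots and l_(n+2) = 2 w^2 <= l_(n+1), the quadratic equation gives (v^2
    - u^2)^2 >= 2 w^2 (u^2 + v^2) >= w^2 (u + v)^2; then u + v cancels. *)
Lemma sqrt_tau_step_ge n : (n.+1 < N)%N ->
  Num.sqrt (t n) + Num.sqrt a / r2 * n.+2%:R `^ (b - 1) <= Num.sqrt (t n.+1).
Proof.
move=> nN; have := tau_quadratic L dl N L_gt0 dl_ge0 tau0_gt0 n nN.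
set u := Num.sqrt (t n); set v := Num.sqrt (t n.+1).
have tn : u ^+ 2 = t n by rewrite sqr_sqrtr// ltW// tpos.
have tSn : v ^+ 2 = t n.+1 by rewrite sqr_sqrtr// ltW// tpos.
have u0 : 0 < u by rewrite sqrtr_gt0 tpos.
have uv : u <= v by rewrite ler_wsqrtr// tle.
have v0 := lt_le_trans u0 uv.
have l12 := invL_dl_nonincreasing n; rewrite -tn -tSn.
have s0 : 0 <= s by rewrite invL_ge0.
have l0 : 0 <= l n.+2 by rewrite invL_ge0.
set w := _ * n.+2%:R `^ _.
have w0 : 0 <= w by rewrite !mulr_ge0 ?invr_ge0 ?sqrtr_ge0 ?powR_ge0.
have lw : l n.+2 = 2 * w ^+ 2.
  rewrite invL_dl /w !exprMn exprVn r2_sqr sqr_sqrtr ?(ltW a_gt0)//.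
  by field.
move: (l n.+1) (l n.+2) l0 l12 lw => k k' k0 kk' kw quad.
have h1 : 0 <= (v ^+ 2 - u ^+ 2) * s by rewrite mulr_ge0// subr_ge0 ler_sqr// nnegrE ltW.
have h2 : u ^+ 2 * k' <= u ^+ 2 * k by rewrite ler_wpM2l// sqr_ge0.
have h3 : (w * (v + u)) ^+ 2 <= (v ^+ 2 - u ^+ 2) ^+ 2.
  rewrite quad; have := mulr_ge0 (sqr_ge0 w) (sqr_ge0 (v - u)).
  rewrite kw in h2 *; nra.
have : w * (v + u) <= v ^+ 2 - u ^+ 2.
  rewrite -ler_sqr ?nnegrE//; first by rewrite mulr_ge0// addr_ge0// ltW.
  by rewrite subr_ge0 ler_sqr// nnegrE ltW.
rewrite (_ : v ^+ 2 - u ^+ 2 = (v - u) * (v + u)); last by ring.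
by rewrite ler_pM2r ?addr_gt0//; lra.
Qed.

(** The increments telescope, as the tangent at n + 2 bounds (n+3)^b - (n+2)^b by b (n+2)^(b-1).
    Subtracting 2^b makes the bound 0 at n = 0. *)
Lemma sqrt_tau_ge n : (n < N)%N ->
  Num.sqrt a / (r2 * b) * (n.+2%:R `^ b - 2 `^ b) <= Num.sqrt (t n).
Proof.
elim: n => [|n IH] nN; first by rewrite subrr mulr0 sqrtr_ge0.
apply: le_trans (sqrt_tau_step_ge n nN).
apply: le_trans (lerD (IH (ltnW nN)) (lexx _)).
have b0 : b != 0 by case/andP: b_bnd => /gt_eqF ->.
have := @powR_tangent R n.+2%:R n.+3%:R b (ltr0Sn _ _) (ler0n _ _) b01.
rewrite -natrB// subSnn mulr1 => h.
have -> : Num.sqrt a / r2 * n.+2%:R `^ (b - 1)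
   = Num.sqrt a / (r2 * b) * (b * n.+2%:R `^ (b - 1)).
  by field; rewrite b0 gt_eqF.
rewrite -mulrDr ler_wpM2l//; last by lra.
by rewrite divr_ge0 ?mulr_ge0 ?sqrtr_ge0//; case/andP: b01.
Qed.

(* The last step size is not the generic one, so monotonicity of [tau] is used
   for it; the asymptotics do not see the loss. *)
Lemma tau_last_ge : (2 <= N)%N ->
  a * ((N.+1%:R `^ b - 2 `^ b) / (r2 * b)) ^+ 2 <= t N.
Proof.
case: N tpos tle sqrt_tau_ge => // n tpos' tle' h n1.
apply: le_trans (tle' n).
rewrite -[leRHS]sqr_sqrtr ?(ltW (tpos' _))//.
have -> : a = Num.sqrt a ^+ 2 by rewrite sqr_sqrtr// ltW.
rewrite -exprMn ler_sqr ?nnegrE ?sqrtr_ge0//.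
  by rewrite mulrA (mulrAC (Num.sqrt a)); exact: h.
rewrite mulr_ge0 ?sqrtr_ge0// divr_ge0// ?mulr_ge0 ?sqrtr_ge0//; last by case/andP: b01.
by rewrite subr_ge0 ge0_ler_powR ?nnegrE// ?ler_nat//; case/andP: b01.
Qed.

Section UpperBound.
Hypothesis s0 : s = 0.
Hypothesis b_ge : 2^-1 <= b.

(* Any [0 < c < b] with [2 * (b - 1) <= c - 1] would do: the corresponding
   term is of lower order than [n `^ b]. *)
Let c := (3 * b - 1) / 2.

(** With e = v - u and k = l_(n+1), the identity u^2 + v^2 = ((u+v)^2 + e^2)/2 turns the quadratic
    equation into e^2 <= k/2 + k e^2 / (2 (u+v)^2), whose last term is of lower order. *)
Lemma sqrt_tau_step_le n : (n.+1 < N)%N ->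
  Num.sqrt (t n.+1) <= Num.sqrt (t n)
    + Num.sqrt a * (n.+1%:R `^ (b - 1) / r2 + n.+1%:R `^ (c - 1)).
Proof.
move=> nN; have := tau_quadratic L dl N L_gt0 dl_ge0 tau0_gt0 n nN.
rewrite s0 mulr0 add0r.
set u := Num.sqrt (t n); set v := Num.sqrt (t n.+1).
have tn : u ^+ 2 = t n by rewrite sqr_sqrtr// ltW// tpos.
have tSn : v ^+ 2 = t n.+1 by rewrite sqr_sqrtr// ltW// tpos.
have u0 : 0 < u by rewrite sqrtr_gt0 tpos.
have uv : u <= v by rewrite ler_wsqrtr// tle.
have ua : a <= u ^+ 2.
  rewrite tn; have : a <= t 0%N by rewrite tau0E s0 addr0.
  by elim: (n) => // m IH /IH /le_trans; apply.
have l12 := invL_dl_nonincreasing n; rewrite -tn -tSn.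
have lE := invL_dl n.
set x := n.+1%:R `^ (b - 1) in lE *.
have x0 : 0 <= x by rewrite powR_ge0.
have xc : x ^+ 2 <= n.+1%:R `^ (c - 1).
  rewrite /x -powR_mulrn ?powR_ge0// -powRrM ler_powR ?ler1n//.
  by rewrite /c; case/andP: b_bnd => *; lra.
set y := n.+1%:R `^ (c - 1) in xc *.
set e := v - u; have vE : v = u + e by rewrite /e subrKC.
have e0 : 0 <= e by rewrite subr_ge0.
set A := Num.sqrt a; have A0 : 0 < A by rewrite sqrtr_gt0.
have aE : a = A ^+ 2 by rewrite sqr_sqrtr// ltW.
move: (l n.+1) (l n.+2) l12 lE => k k' kk' kE quad.
have uu0 : 0 < (v + u) ^+ 2 by rewrite exprn_gt0// vE; lra.
have k0 : 0 <= k by rewrite kE mulr_ge0 ?sqr_ge0// ltW.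
have q1 : (e * (v + u)) ^+ 2 <= k * (v ^+ 2 + u ^+ 2).
  have -> : e * (v + u) = v ^+ 2 - u ^+ 2 by rewrite vE; ring.
  by rewrite quad; have := ler_wpM2l (sqr_ge0 v) kk'; nra.
(* A crude bound, from u^2 + v^2 <= (u+v)^2; it is fed into the last term below, together with
   (u+v)^2 >= 4 a. *)
have q2 : e ^+ 2 <= k.
  rewrite -(ler_pM2r uu0) -exprMn (le_trans q1)// ler_wpM2l//.
  by rewrite vE; nra.
have q3 : e ^+ 2 <= k / 2 + k ^+ 2 / (8 * a).
  have uu4 : 4 * a <= (v + u) ^+ 2 by rewrite vE; nra.
  have q4 : e ^+ 2 * (v + u) ^+ 2 <= k / 2 * (v + u) ^+ 2 + k / 2 * e ^+ 2.
    by rewrite -exprMn (le_trans q1)// vE; nra.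
  have q5 : k / 2 * e ^+ 2 <= k ^+ 2 / (8 * a) * (v + u) ^+ 2.
    apply: le_trans (_ : _ <= k / 2 * k) _; first by rewrite ler_wpM2l// divr_ge0.
    apply: le_trans (_ : _ <= k ^+ 2 / (8 * a) * (4 * a)) _.
      by rewrite le_eqVlt; apply/orP; left; apply/eqP; field; rewrite gt_eqF.
    by rewrite ler_wpM2l// divr_ge0 ?sqr_ge0// mulr_ge0// ltW.
  by rewrite -(ler_pM2r uu0) mulrDl; lra.
rewrite vE lerD2l.
have y0 : 0 <= y by rewrite powR_ge0.
have rhs0 : 0 <= A * (x / r2 + y).
  by rewrite mulr_ge0 ?addr_ge0 ?divr_ge0 ?(ltW A0)// ltW.
rewrite -ler_sqr ?nnegrE//.
apply: le_trans q3 _.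
have -> : k / 2 + k ^+ 2 / (8 * a) = A ^+ 2 * (x ^+ 2 / 2 + (x ^+ 2) ^+ 2 / 8).
  by rewrite kE aE; field; rewrite gt_eqF.
rewrite [in leRHS]exprMn ler_wpM2l ?sqr_ge0// sqrrD [in leRHS]exprMn exprVn r2_sqr.
(* Because x^2 <= y, the square of x / sqrt 2 + y dominates x^2/2 + x^4/8. *)
have h1 : (x ^+ 2) ^+ 2 <= y ^+ 2 by rewrite ler_sqr ?nnegrE// sqr_ge0.
have h2 : 0 <= x / r2 * y *+ 2 by rewrite mulrn_wge0 ?mulr_ge0 ?invr_ge0 ?(ltW r2_gt0).
have := sqr_ge0 (x ^+ 2); lra.
Qed.

(** The step bounds are summed by means of the tangents at n + 1 evaluated at n; the summand 1
    accounts for tau_0, which is [a] when [s = 0]. *)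
Lemma sqrt_tau_le n : (n < N)%N ->
  Num.sqrt (t n) <= Num.sqrt a * (1 + n%:R `^ b / (r2 * b) + n%:R `^ c / c).
Proof.
have b0 : 0 < b by case/andP: b_bnd.
have c0 : 0 < c by rewrite /c; move: b_ge; lra.
have c1 : c <= 1 by rewrite /c; case/andP: b_bnd => *; lra.
elim: n => [|n IH] nN.
  by rewrite tau0E s0 addr0 !powR0 ?gt_eqF// !mul0r !addr0 mulr1.
apply: le_trans (sqrt_tau_step_le n nN) _.
apply: le_trans (lerD (IH (ltnW nN)) (lexx _)) _.
rewrite -mulrDr ler_wpM2l ?sqrtr_ge0//.
have hb := @powR_tangent R n.+1%:R n%:R b (ltr0Sn _ _) (ler0n _ _) b01.
have c01 : 0 <= c <= 1 by rewrite ltW.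
have hc := @powR_tangent R n.+1%:R n%:R c (ltr0Sn _ _) (ler0n _ _) c01.
have nn : n%:R - n.+1%:R = -1 :> R by rewrite -natr1; ring.
rewrite nn mulrN1 in hb; rewrite nn mulrN1 in hc.
have h1 : n%:R `^ b / (r2 * b) + n.+1%:R `^ (b - 1) / r2 <= n.+1%:R `^ b / (r2 * b).
  have -> : n.+1%:R `^ (b - 1) / r2 = b * n.+1%:R `^ (b - 1) / (r2 * b).
    by field; rewrite !gt_eqF.
  by rewrite -mulrDl ler_wpM2r ?invr_ge0 ?mulr_ge0 ?(ltW b0) ?(ltW r2_gt0)//; lra.
have h2 : n%:R `^ c / c + n.+1%:R `^ (c - 1) <= n.+1%:R `^ c / c.
  rewrite -[X in _ + X](mulfK (lt0r_neq0 c0)) -mulrDl.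
  by rewrite ler_wpM2r ?invr_ge0 ?(ltW c0)//; lra.
lra.
Qed.

End UpperBound.
End TauGrowth.

(** * The power law for L and the optimal tolerances *)

Section PowerL.
Context {R : realType} (kappa q : R).
Hypothesis kappa_gt0 : 0 < kappa.

Lemma powerL_gt0 delta : (0 < powerL kappa q delta)%E.
Proof.
rewrite /powerL inver; case: ifP => [_|d0]; first by rewrite mulry gtr0_sg// mul1e.
by rewrite -EFinM lte_fin divr_gt0// lt_def d0 powR_ge0.
Qed.

(** Where the power of [delta] vanishes, L is infinite and both sides are 0. *)
Lemma invL_powerL delta : invL (powerL kappa q) delta = delta `^ q / kappa.
Proof.
rewrite /invL /powerL inver; case: ifP => [/eqP ->|/negbT d0].
  by rewrite mulry gtr0_sg// mul1e mul0r.
by rewrite -EFinM inver mulf_eq0 invr_eq0 (negPf d0) gt_eqF//= invf_div.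
Qed.

End PowerL.

Section OptimalTolerances.
Context {R : realType} (kappa q D : R).
Hypothesis kappa_gt0 : 0 < kappa.
Hypothesis q_bnd : 0 <= q <= 1.
Hypothesis D_gt0 : 0 < D.

Let L := powerL kappa q.
Let b : R := (q + 1)^-1.
Let c : R := (3 * b - 1) / 2.
Local Notation r2 := (Num.sqrt 2 : R).
Local Notation dl N := (opt_tol kappa q D N).
Local Notation t N := (tau L (dl N) zero_tol N).

(** [A N] is the factor of the tolerances depending on N alone, and [a N] the matching factor of
    1/L. [X N] vanishes exactly when q = 0. *)
Let X N : R := q * kappa * D ^+ 2 / ((q + 1) ^+ 2 * N.+1%:R).
Let A N : R := X N `^ b.
Let a N : R := A N `^ q / kappa.

Let q_ge0 : 0 <= q. Proof. by case/andP: q_bnd. Qed.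
Let q1_gt0 : 0 < q + 1. Proof. by rewrite ltr_wpDl. Qed.
Let b_gt0 : 0 < b. Proof. by rewrite invr_gt0. Qed.
Let b_le1 : b <= 1. Proof. by rewrite invf_le1// lerDr. Qed.
Let b_bnd : 0 < b <= 1. Proof. by rewrite b_gt0. Qed.
Let b_ge : 2^-1 <= b.
Proof. by rewrite lef_pV2 ?posrE//; case/andP: q_bnd => *; lra. Qed.
Let r2_gt0 : 0 < r2. Proof. by rewrite sqrtr_gt0 ltr0n. Qed.
Let r2_sqr : r2 ^+ 2 = 2. Proof. by rewrite sqr_sqrtr// ler0n. Qed.
Let qb : q * b = 1 - b. Proof. by rewrite /b; field; rewrite gt_eqF. Qed.

Let X_ge0 N : 0 <= X N.
Proof. by rewrite !(mulr_ge0, invr_ge0) ?exprn_ge0// ltW. Qed.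

Let X_gt0 N : q != 0 -> 0 < X N.
Proof.
move=> q0; rewrite /X divr_gt0 ?mulr_gt0 ?exprn_gt0//.
by rewrite lt_def q0.
Qed.

Let a_gt0 N : 0 < a N.
Proof.
rewrite divr_gt0//; have [->|q0] := eqVneq q 0; first by rewrite powRr0.
by rewrite !powR_gt0// X_gt0.
Qed.

Let dlE N n : dl N n = A N * n%:R `^ (- (2 * b)).
Proof. by rewrite /opt_tol div1r. Qed.

Lemma opt_tol_ge0 N n : 0 <= dl N n.
Proof. by rewrite mulr_ge0// powR_ge0. Qed.

Let invL_dl N n : invL L (dl N n.+1) = a N * (n.+1%:R `^ (b - 1)) ^+ 2.
Proof.
rewrite invL_powerL// dlE powRM ?powR_ge0// /a mulrAC; congr (_ * _).
rewrite -powRrM -powR_mulrn ?powR_ge0// -powRrM; congr (_ `^ _).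
have := qb; lra.
Qed.

Let L_gt0 delta : 0 <= delta -> (0 < L delta)%E.
Proof. by move=> _; exact: powerL_gt0. Qed.

Let invL0 : q != 0 -> invL L 0 = 0.
Proof. by move=> q0; rewrite invL_powerL// powR0// mul0r. Qed.

(** A^(q+1) = X gives a A = X / kappa, whose factor 1/(N+1) cancels N + 1. This is what turns the
    bound on sigma_N into an average. *)
Let aA N : a N * A N * N.+1%:R = q * D ^+ 2 * b ^+ 2.
Proof.
have -> : a N * A N = X N / kappa.
  have [q0|q0] := eqVneq q 0.
    rewrite /a /A /X /b q0 !mul0r add0r invr1 powRr0 powR0 ?oner_neq0//.
    by rewrite mulr0.
  have A0 : 0 < A N by rewrite powR_gt0// X_gt0.
  rewrite /a mulrAC -{2}(powRr1 (ltW A0)) -powRD ?(gt_eqF A0) ?implybT//.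
  by rewrite /A -powRrM mulVf ?gt_eqF// powRr1 ?X_ge0.
by rewrite /X /b; field; rewrite !gt_eqF.
Qed.

(** For q > 0 this bounds tau_k delta_(k,k+1) / (a A), independently of N: it is the bound of
    [sqrt_tau_le] with k replaced by k + 1, so that its powers combine with that of the
    tolerance. *)
Definition sigma_weight (k : nat) : R :=
  (k.+1%:R `^ (- b) * (1 + k.+1%:R `^ b / (r2 * b) + k.+1%:R `^ c / c)) ^+ 2.

Lemma sigma_opt_tol_le N :
  sigma L (dl N) zero_tol N
  <= q * D ^+ 2 * b ^+ 2 * arithmetic_mean sigma_weight N.
Proof.
have c_gt0 : 0 < c by rewrite /c; move: b_ge; lra.
rewrite -(aA N) /arithmetic_mean /= -(mulrA (_ * A N)) (mulrA N.+1%:R) divff// mul1r.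
rewrite /sigma seriesEnat /= big_add1 /= mulr_sumr.
(* The mean has N + 1 terms and sigma_N only N; the last one is nonnegative and dropped. *)
rewrite [leRHS]big_nat_recr//=; apply: ler_wpDr.
  by rewrite mulr_ge0 ?sqr_ge0// mulr_ge0 ?powR_ge0// ltW.
(* For q = 0 the tolerances are 0 while 1/L(0) is not, so [sqrt_tau_le] does not apply. *)
have [q0|q0] := eqVneq q 0.
  rewrite big1.
    by apply: sumr_ge0 => i _; rewrite mulr_ge0 ?sqr_ge0// mulr_ge0 ?powR_ge0// ltW.
  by move=> i _; rewrite dlE /A /X q0 !mul0r powR0 ?mul0r ?mulr0// gt_eqF.
rewrite big_nat_cond [leRHS]big_nat_cond; apply: ler_sum => k /andP[/andP[_ kN] _].
have t0 : 0 < t N 0%N by rewrite (tau0E L (dl N) N (a N) b (invL_dl N)) invL0// addr0.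
have tk : 0 < t N k by exact: (tau_gt0 L (dl N) N L_gt0 (opt_tol_ge0 N) t0).
have := sqrt_tau_le L (dl N) N (a N) b L_gt0 (opt_tol_ge0 N) (a_gt0 N) b_bnd
  (invL_dl N) (invL0 q0) b_ge k kN.
rewrite -/c => h.
rewrite dlE -(sqr_sqrtr (ltW tk)) /sigma_weight.
have -> : - (2 * b) = - b * 2%:R by ring.
rewrite powRrM powR_mulrn ?powR_ge0// exprMn.
set V := _ + _ in h *; set W := 1 + _ + _.
have VW : V <= W.
  have hp e : 0 <= e -> k%:R `^ e <= k.+1%:R `^ e :> R.
    by move=> e0; rewrite ge0_ler_powR ?nnegrE ?ler_nat.
  apply: lerD; [apply: lerD => //|]; apply: ler_wpM2r; rewrite ?hp ?invr_ge0 ?ltW//.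
  exact: mulr_gt0.
have V0 : 0 <= V.
  rewrite /V !addr_ge0// divr_ge0 ?powR_ge0//; last exact: ltW.
  by rewrite ltW// mulr_gt0.
have {}h : Num.sqrt (t N k) ^+ 2 <= a N * W ^+ 2.
  rewrite -(sqr_sqrtr (ltW (a_gt0 N))) -exprMn ler_sqr ?nnegrE ?sqrtr_ge0//.
    by apply: le_trans h _; rewrite ler_wpM2l// sqrtr_ge0.
  by rewrite mulr_ge0 ?sqrtr_ge0// (le_trans V0).
have := ler_wpM2r _ h.
move=> /(_ (A N * (k.+1%:R `^ (- b)) ^+ 2)).
rewrite mulr_ge0 ?sqr_ge0 ?powR_ge0// => /(_ isT) /le_trans; apply.
by rewrite le_eqVlt; apply/orP; left; apply/eqP; ring.
Qed.

Definition rate N : R := kappa `^ b * D `^ (2 * b) / N.+1%:R `^ ((2 - q) * b).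

Definition rate_const : R := (q + 1) `^ ((q - 1) * b) / q `^ (q * b).

(** The left side is the limit form of the bound: D^2 (1+q)/2 = D^2/(2b) divided by a (N+1)^(2b) /
    (2 b^2). For q > 0 the identity is checked on logarithms; at q = 0 the convention 0^0 = 1
    decides. *)
Lemma rate_constE N :
  D ^+ 2 * b / (a N * (N.+1%:R `^ b) ^+ 2) = rate_const * rate N.
Proof.
rewrite /rate /rate_const /a /A -powRrM.
have [q0|q0] := eqVneq q 0.
  rewrite /X /b q0 !(mul0r, mulr0, add0r, invr1, mulr1, subr0, sub0r, powRr0).
  by rewrite powR1 !powRr1 ?ler0n ?ltW// !powR_mulrn ?ltW//; field; rewrite !gt_eqF.
have qgt0 : 0 < q by rewrite lt_def q0.
have N0 : 0 < N.+1%:R :> R by [].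
have powE x y : 0 < x -> x `^ y = expR (y * ln x) by move=> x0; rewrite /powR gt_eqF.
have invE (x : R) : 0 < x -> x^-1 = expR (- ln x) by move=> x0; rewrite expRN lnK.
have sqrE (x : R) : 0 < x -> x ^+ 2 = expR (2 * ln x).
  by move=> x0; rewrite -powE// powR_mulrn// ltW.
have lnX : ln (X N) = ln q + ln kappa + 2 * ln D - (2 * ln (q + 1) + ln N.+1%:R).
  rewrite /X ln_div ?posrE ?mulr_gt0 ?exprn_gt0// !lnM ?posrE ?mulr_gt0 ?exprn_gt0//.
  by ring.
rewrite !(powE, invE, sqrE) ?(X_gt0, expR_gt0, mulr_gt0)//.
rewrite {1}/b.
rewrite !(invE, sqrE) ?(X_gt0, expR_gt0, mulr_gt0, invr_gt0)//.
rewrite !(lnM, expRK, lnX) ?posrE ?(expR_gt0, mulr_gt0)//.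
rewrite -!expRD; congr expR; rewrite /b.
by field; rewrite gt_eqF.
Qed.


Lemma opt_tau0_gt0 N : 0 < t N 0%N.
Proof.
rewrite (tau0E L (dl N) N (a N) b (invL_dl N)) ltr_wpDr//.
exact: (invL_ge0 L L_gt0).
Qed.

(** What remains in the lower bound of [tau_last_ge] once (N+1)^b is factored out. *)
Definition leading_gap N : R := (1 - 2 `^ b * N.+1%:R `^ (- b)) / (r2 * b).

Definition bound_factor N : R :=
  (2^-1 + q * (b ^+ 2 * arithmetic_mean sigma_weight N)) / (b * leading_gap N ^+ 2).

Lemma bound_le N : (2 <= N)%N ->
  (D ^+ 2 / 2 + sigma L (dl N) zero_tol N) / t N N
  <= rate_const * bound_factor N * rate N.
Proof.
move=> N2.
have := tau_last_ge L (dl N) N (a N) b L_gt0 (opt_tol_ge0 N) (a_gt0 N) b_bnd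
  (invL_dl N) N2.
have Nb0 : 0 < N.+1%:R `^ b :> R by rewrite powR_gt0.
have -> : (N.+1%:R `^ b - 2 `^ b) / (r2 * b) = N.+1%:R `^ b * leading_gap N.
  by rewrite /leading_gap powRN; field; rewrite !gt_eqF.
(* Positive because N + 1 > 2; at N = 1 the gap would be 0. *)
have gap0 : 0 < leading_gap N.
  rewrite divr_gt0 ?mulr_gt0// powRN subr_gt0 ltr_pdivrMr// mul1r.
  by rewrite gt0_ltr_powR ?nnegrE// ltr_nat.
set h := a N * _ => ht.
have h0 : 0 < h by exact: mulr_gt0 (a_gt0 N) (exprn_gt0 2 (mulr_gt0 Nb0 gap0)).
have num0 : 0 <= D ^+ 2 / 2 + sigma L (dl N) zero_tol N.
  rewrite addr_ge0 ?divr_ge0 ?sqr_ge0// /sigma big_nat_cond sumr_ge0// => i /andP[/andP[i0 _] _].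
  apply: mulr_ge0; last exact: opt_tol_ge0.
  exact: ltW (tau_gt0 L (dl N) N L_gt0 (opt_tol_ge0 N) (opt_tau0_gt0 N) _).
apply: le_trans (_ : _ <= (D ^+ 2 / 2 + sigma L (dl N) zero_tol N) / h) _.
  by rewrite ler_wpM2l// lef_pV2 ?posrE// (lt_le_trans h0).
apply: le_trans (_ : _ <= (D ^+ 2 / 2
    + q * D ^+ 2 * b ^+ 2 * arithmetic_mean sigma_weight N) / h) _.
  by rewrite ler_wpM2r ?invr_ge0 ?(ltW h0)// lerD2l sigma_opt_tol_le.
rewrite [in leRHS]mulrAC -rate_constE /bound_factor /h le_eqVlt; apply/orP; left; apply/eqP.
by field; rewrite !gt_eqF.
Qed.

(** Only the middle term survives: q > 0 gives b < 1, hence b - c = (1-b)/2 > 0. *)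
Lemma sigma_weight_cvg : q != 0 ->
  sigma_weight k @[k --> \oo] --> (2 * b ^+ 2)^-1.
Proof.
move=> q0; have q_gt0 : 0 < q by rewrite lt_def q0.
have b_lt1 : b < 1 by rewrite invf_lt1// ltrDr.
have bc : 0 < b - c by rewrite /c; lra.
have c_gt0 : 0 < c by rewrite /c; move: b_ge; lra.
have -> : sigma_weight = fun k =>
    (k.+1%:R `^ (- b) + (r2 * b)^-1 + k.+1%:R `^ (- (b - c)) / c) ^+ 2.
  apply/funext => k; rewrite /sigma_weight; congr (_ ^+ 2).
  have k0 : 0 < k.+1%:R `^ b :> R by rewrite powR_gt0.
  rewrite opprB powRB ?pnatr_eq0 ?implybT// powRN; field.
  by rewrite !gt_eqF.
have -> : (2 * b ^+ 2)^-1 = (0 + (r2 * b)^-1 + 0 / c) ^+ 2.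
  by rewrite mul0r addr0 add0r exprVn exprMn r2_sqr.
apply: cvgM; (apply: cvgD; [apply: cvgD; [exact: powR_natS_cvg0|exact: cvg_cst]|]);
  by apply: cvgMl; exact: powR_natS_cvg0.
Qed.

Lemma bound_factor_cvg : bound_factor N @[N --> \oo] --> (1 : R).
Proof.
have gap : leading_gap N @[N --> \oo] --> (r2 * b)^-1.
  rewrite -[X in _ --> X]mul1r; apply: cvgMl.
  rewrite -[X in _ --> X]subr0; apply: cvgB; first exact: cvg_cst.
  by rewrite -(mulr0 (2 `^ b)); apply: cvgMr; exact: powR_natS_cvg0.
have mean : q * (b ^+ 2 * arithmetic_mean sigma_weight N) @[N --> \oo] --> q / 2.
  (* At q = 0 the weights have another limit, but the factor q kills the mean. *)
  have [->|q0] := eqVneq q 0.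
    rewrite mul0r (_ : (fun N => _) = cst 0); first exact: cvg_cst.
    by apply/funext => N; rewrite mul0r.
  have -> : q / 2 = q * (b ^+ 2 * (2 * b ^+ 2)^-1) by field; rewrite gt_eqF.
  by do 2 apply: cvgMr; apply: cesaro; exact: sigma_weight_cvg.
(* The limit is (1+q)/2 times 2 b, and b (q+1) = 1. *)
have -> : (1 : R) = (2^-1 + q / 2) * (b * ((r2 * b)^-1 * (r2 * b)^-1))^-1.
  have -> : b * ((r2 * b)^-1 * (r2 * b)^-1) = (r2 ^+ 2 * b)^-1.
    by field; rewrite !gt_eqF.
  by rewrite r2_sqr invrK /b; field; rewrite gt_eqF.
apply: cvgM; first by apply: cvgD => //; exact: cvg_cst.
apply: cvgV; first by rewrite !mulf_neq0 ?invr_eq0 ?mulf_neq0// gt_eqF.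
by apply: cvgMr; exact: cvgM.
Qed.

End OptimalTolerances.

(** [eps] is the positive part of the excess B/r - C. It makes the bound hold for every N, including
    the finitely many where [G] gives none, and is eventually at most |G - C|. *)
Lemma eventual_bound_eps {R : realType} (B r G : nat -> R) (C : R) :
  (forall N, 0 < r N) -> (\forall N \near \oo, B N <= G N * r N) ->
  G @ \oo --> C ->
  exists eps : nat -> R, eps @ \oo --> (0 : R) /\ forall N, B N <= (C + eps N) * r N.
Proof.
move=> r0 BG GC; exists (fun N => Num.max 0 (B N / r N - C)); split; last first.
  by move=> N; rewrite -ler_pdivrMr// -lerBlDl le_max lexx orbT.
have up : `|G N - C| @[N --> \oo] --> (0 : R).
  rewrite -(normr0 R) -(subrr C); apply: cvg_norm; apply: cvgB => //.
  exact: cvg_cst.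
apply: (squeeze_cvgr _ (cvg_cst 0) up).
near=> N; rewrite le_max lexx /= ge_max normr_ge0 /=.
apply: le_trans (ler_norm _); rewrite lerD2r ler_pdivrMr//.
by near: N.
Unshelve. all: by end_near. Qed.

(** * Hoelder smooth functions *)

Section EuclideanTopology.
Context {R : realType} {d : nat}.
Implicit Types u v w : 'rV[R]_d.

Lemma norm2D u v : norm2 (u + v) <= norm2 u + norm2 v.
Proof.
rewrite -ler_sqr ?nnegrE ?addr_ge0 ?norm2_ge0// sqrrD !norm2_sqr !dotE (dotC v u).
have := Cauchy_Schwarz u v; rewrite mulr2n; lra.
Qed.

Lemma coord_le_norm2 v i : `|v 0 i| <= norm2 v.
Proof.
rewrite -ler_sqr ?nnegrE ?norm2_ge0// norm2_sqr real_normK ?num_real//.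
rewrite /dot (bigD1 i)//= expr2 lerDl sumr_ge0// => j _.
by rewrite -expr2 sqr_ge0.
Qed.

(** A box, unlike a Euclidean ball, is a product of segments. *)
Lemma box_compact w (r : R) : compact [set v : 'rV[R]_d | forall i, `|v 0 i - w 0 i| <= r].
Proof.
have -> : [set v : 'rV[R]_d | forall i, `|v 0 i - w 0 i| <= r]
    = [set v : 'rV[R]_d | forall i, `[w 0 i - r, w 0 i + r]%classic (v ord0 i)].
  apply/seteqP; split => v /= h i; have := h i.
    by rewrite in_itv /= ler_distl.
  by rewrite in_itv /= ler_distl.
apply: (@rV_compact R d (fun i => `[w 0 i - r, w 0 i + r]%classic)) => i.
exact: segment_compact.
Qed.

Lemma dot_cvg (T : Type) (F : set_system T) {FF : Filter F} (u v : T -> 'rV[R]_d)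
    (a b : 'rV[R]_d) :
  u x @[x --> F] --> a -> v x @[x --> F] --> b ->
  dot (u x) (v x) @[x --> F] --> dot a b.
Proof.
move=> ua vb; rewrite /dot.
apply: (cvg_big (@add_continuous R) (Ff := fun i x => u x 0 i * v x 0 i)) => i _.
apply: cvgM.
  apply: (@continuous_cvg _ _ _ F FF u (fun M : 'rV[R]_d => M 0 i) a _ ua).
  exact: coord_continuous.
apply: (@continuous_cvg _ _ _ F FF v (fun M : 'rV[R]_d => M 0 i) b _ vb).
exact: coord_continuous.
Qed.

Lemma continuous_dotl w : continuous (fun v => dot v w).
Proof.
move=> v; exact: (@dot_cvg _ (nbhs v) (nbhs_filter v) id (cst w) v w cvg_id (cvg_cst w)).
Qed.

Lemma continuous_sqr_dist w : continuous (fun v => dot (v - w) (v - w)).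
Proof.
move=> v; have vw : x - w @[x --> v] --> v - w by exact: (cvgB cvg_id (cvg_cst w)).
exact: (@dot_cvg _ (nbhs v) (nbhs_filter v) _ _ _ _ vw vw).
Qed.

Lemma norm2_cvg (u : nat -> 'rV[R]_d) w (c : nat -> R) :
  (forall n, norm2 (u n - w) <= c n) -> c n @[n --> \oo] --> (0 : R) ->
  u n @[n --> \oo] --> w.
Proof.
move=> uc c0 V /nbhs_ballP[e /= e0 eV].
have /cvgrPdist_lt /(_ e e0) := c0.
apply: filterS => n /= ne; apply: eV; split=> // i j.
rewrite /ball /= distrC (ord1 i); have := coord_le_norm2 (u n - w) j; rewrite !mxE.
move=> /le_lt_trans; apply; apply: le_lt_trans (uc n) _.
by apply: le_lt_trans ne; rewrite sub0r normrN ler_norm.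
Qed.

End EuclideanTopology.

(** The sublevel sets within K form a filter base; a cluster point [u] is a minimizer, since a
    smaller value at [v] would give a neighbourhood of [u] disjoint from the sublevel set of [v]. *)
Lemma lsc_compact_min {R : realType} (T : topologicalType) (h : T -> \bar R) (K : set T) :
  lower_semicontinuous h -> (forall x, h x != -oo%E) -> compact K -> K !=set0 ->
  exists2 u, K u & forall v, K v -> (h u <= h v)%E.
Proof.
move=> lsc hN Kc K0.
pose S v := K `&` [set w | (h w <= h v)%E].
have FS : ProperFilter (filter_from K S).
  apply: filter_from_proper; last by move=> v Kv; exists v; split => /=.
  apply: filter_from_filter => // i j Ki Kj.
  have [hij|hij] := leP (h i) (h j).
    by exists i => // w [Kw wi]; split; split => //; apply: le_trans wi hij.
  by exists j => // w [Kw wj]; split; split => //; apply: le_trans wj (ltW hij).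
have FK : filter_from K S K by case: K0 => v Kv; exists v => // w [].
have [u [Ku cu]] := Kc _ FS FK.
exists u => // v Kv; rewrite leNgt; apply/negP => vu.
have [r hv] : exists r, h v = r%:E.
  by case: (h v) (hN v) vu => [r _ _|_|//]; [exists r|rewrite ltNge leey].
rewrite hv in vu; have [V Vu hV] := lsc _ _ vu.
have Sv : filter_from K S (S v) by exists v.
have [w [[_ wv] Vw]] := cu _ _ Sv Vu.
by have := lt_le_trans (hV w Vw) wv; rewrite hv ltxx.
Qed.

Lemma lte_EFin_room {R : realType} (r : R) (x : \bar R) : (r%:E < x)%E ->
  exists2 e : R, 0 < e & ((r + e)%:E < x)%E.
Proof.
case: x => [s| |]//; last by exists 1 => //; rewrite ltry.
by rewrite lte_fin => rs; exists ((s - r) / 2); rewrite ?lte_fin; lra.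
Qed.

Lemma lower_semicontinuousD {R : realType} (T : topologicalType)
    (f : T -> \bar R) (phi : T -> R) :
  lower_semicontinuous f -> continuous phi ->
  lower_semicontinuous (fun x => (f x + (phi x)%:E)%E).
Proof.
move=> lsc cphi x a; rewrite -lteBlDr// -EFinB => /lte_EFin_room[e e0 ax].
have [V Vx fV] := lsc _ _ ax.
have /cvgrPdist_lt /(_ e e0) phx := cphi x.
exists (V `&` [set y | `|phi x - phi y| < e]); first exact: filterI.
move=> y [Vy /= xy]; rewrite -lteBlDr// -EFinB; apply: le_lt_trans (fV y Vy).
by rewrite lee_fin; have := ler_norm (phi x - phi y); lra.
Qed.

Lemma le0_of_le_harmonic {R : realType} (x c : R) : 0 <= c ->
  (forall n : nat, x <= c / n.+1%:R) -> x <= 0.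
Proof.
move=> c0 h; rewrite leNgt; apply/negP => x0.
have := archi_boundP (divr_ge0 c0 (ltW x0)); set n := Num.bound _ => cn.
have := h n; rewrite ler_pdivlMr// -natr1.
rewrite ltr_pdivrMr// in cn; nra.
Qed.

(** * Proximal points and subgradients *)

Section Proximal.
Context {R : realType} {d : nat} (f : 'rV[R]_d -> \bar R) (xs : 'rV[R]_d).
Hypothesis f_cvx : closed_proper_convex f.
Hypothesis xs_min : minimizer f xs.

Let f_proper : Defs.proper f. Proof. by case: f_cvx. Qed.

(* [u] minimizes [v |-> f v + |v - y| ^ 2 / (2 lambda)]; a minimizer over the
   box around [y] through [xs] is a global one since [f] is minimal at [xs]. *)
Lemma prox_exists (y : 'rV[R]_d) (lambda : R) : 0 < lambda ->
  exists u, subdifferential f u (lambda^-1 *: (y - u)) /\ norm2 (u - y) <= norm2 (xs - y).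
Proof.
move=> l0; have [[fN _] lsc cvx] := f_cvx.
pose phi (v : 'rV[R]_d) : R := dot (v - y) (v - y) / (2 * lambda).
have cphi : continuous phi.
  by move=> v; exact: (@cvgMl _ _ (nbhs v) (nbhs_filter v) _ _ _ (continuous_sqr_dist y v)).
have ll : 0 < 2 * lambda by rewrite mulr_gt0.
pose h (v : 'rV[R]_d) := (f v + (phi v)%:E)%E.
pose K := [set v : 'rV[R]_d | forall i, `|v 0 i - y 0 i| <= norm2 (xs - y)].
have inK v : norm2 (v - y) <= norm2 (xs - y) -> K v.
  move=> vy i; apply: le_trans vy; have := coord_le_norm2 (v - y) i.
  by rewrite !mxE.
have hN v : h v != -oo%E by rewrite /h adde_eq_ninfty negb_or fN.
have [u Ku hK] := lsc_compact_min _ h K (lower_semicontinuousD _ f phi lsc cphi) hN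
  (box_compact y _) (ex_intro _ xs (inK xs (lexx _))).
have fs := minimizer_fin_num f f_proper xs xs_min.
have hu v : (h u <= h v)%E.
  have [vy|vy] := leP (norm2 (v - y)) (norm2 (xs - y)); first by apply: hK; exact: inK.
  (* If [v] is farther from [y] than [xs] is, both terms of [h] are no larger at [xs]. *)
  apply: le_trans (hK xs (inK xs (lexx _))) _; rewrite leeD ?xs_min// lee_fin.
  by rewrite ler_pM2r ?invr_gt0// -!norm2_sqr ler_sqr ?nnegrE ?norm2_ge0// ltW.
have fu : f u \is a fin_num.
  have := hu xs; rewrite /h -(fineK fs) -EFinD.
  by rewrite fin_numE fN /=; case: (f u).
(* [h u <= h xs] and [f xs <= f u] leave the comparison of the quadratic terms. *)
exists u; split; last first.
  have := hu xs; rewrite /h -(fineK fs) -(fineK fu) -!EFinD lee_fin /phi.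
  have := xs_min u; rewrite -(fineK fs) -(fineK fu) lee_fin => A B.
  rewrite -ler_sqr ?nnegrE ?norm2_ge0// !norm2_sqr -(ler_pM2r (x := (2 * lambda)^-1)) ?invr_gt0//.
  lra.
move=> v; case E : (f v) => [r| |]; last by have := fN v; rewrite E.
- rewrite -(fineK fu) -EFinD lee_fin.
  set F := fine _; set V := v - u.
  (* Convexity and optimality of [u] against u + V/m bound the left side by |V|^2 / (2 lambda m). *)
  suff : F + dot (lambda^-1 *: (y - u)) V - r <= 0 by lra.
  apply: (le0_of_le_harmonic _ (dot V V / (2 * lambda))) => [|n].
    by rewrite divr_ge0 ?dotvv_ge0 ?ltW.
  have := ltr0Sn R n; set m := n.+1%:R => m0.
  have m1 : m^-1 <= 1 by rewrite invf_le1// ler1n.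
  have m01 : 0 <= m^-1 <= 1 by rewrite invr_ge0 ltW.
  have := hu (m^-1 *: v + (1 - m^-1) *: u).
  rewrite /h => /le_trans /(_ (leeD (cvx v u _ m01) (lexx _))).
  rewrite E -(fineK fu) -/F -!EFinM -!EFinD lee_fin /phi.
  have -> : m^-1 *: v + (1 - m^-1) *: u - y = (u - y) + m^-1 *: V.
    by apply/matrixP => i j; rewrite !mxE; ring.
  have -> : lambda^-1 *: (y - u) = - (lambda^-1 *: (u - y)).
    by rewrite -scalerN opprB.
  clearbody V; move: (u - y) => W; rewrite !dotE (dotC V W).
  move: (dot W W) (dot W V) (dot V V) => ww wv vv hh.
  rewrite -(ler_pM2l (x := m^-1)) ?invr_gt0//.
  move: (m^-1) m0 hh => k _ hh.
  have E1 : (2 * lambda)^-1 * 2 = lambda^-1 by field; rewrite gt_eqF.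
  rewrite -E1; move: (2 * lambda)^-1 hh => e; nra.
- by rewrite leey.
Qed.

End Proximal.

Section HolderSmooth.
Context {R : realType} {d : nat} (f : 'rV[R]_d -> \bar R) (xs : 'rV[R]_d) (beta p : R).
Hypothesis f_cvx : closed_proper_convex f.
Hypothesis xs_min : minimizer f xs.
Hypothesis f_holder : holder_smooth beta p f.
Hypothesis beta_gt0 : 0 < beta.
Hypothesis p_bnd : 0 <= p <= 1.

Let f_proper : Defs.proper f. Proof. by case: f_cvx. Qed.
Let p_ge0 : 0 <= p. Proof. by case/andP: p_bnd. Qed.

(* Proximal points with parameters [1/n] tend to [y], and their subgradients
   are bounded by Hoelder smoothness; any cluster point will do. *)
Lemma holder_subgradient_exists (y : 'rV[R]_d) : exists g, subdifferential f y g.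
Proof.
have [[fN _] lsc _] := f_cvx.
have inv_gt0 (n : nat) : 0 < n.+1%:R^-1 :> R by rewrite invr_gt0.
have /choice[u uP] n := prox_exists f xs f_cvx xs_min y _ (inv_gt0 n).
pose g n := n.+1%:R *: (y - u n).
have gP n : subdifferential f (u n) (g n) by have [] := uP n; rewrite invrK.
(* [xs] carries the subgradient 0 and |u_n - xs| <= 2 |xs - y|. *)
pose G := beta * (2 * norm2 (xs - y)) `^ p.
have gG n : norm2 (g n) <= G.
  have := f_holder (u n) xs (g n) 0 (gP n) (minimizer_subdifferential f xs xs_min).
  rewrite subr0 => /le_trans; apply; rewrite ler_wpM2l ?(ltW beta_gt0)//.
  rewrite ge0_ler_powR ?nnegrE ?mulr_ge0 ?norm2_ge0//.
  have -> : u n - xs = (u n - y) + - (xs - y) by rewrite opprB subrKA.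
  by apply: le_trans (norm2D _ _) _; rewrite norm2N; have [_] := uP n; lra.
have u_cvg : u n @[n --> \oo] --> y.
  apply: (norm2_cvg _ _ (fun n => G * harmonic n)) => [n|]; last first.
    by rewrite -(mulr0 G); apply: cvgMr; exact: cvg_harmonic.
  have -> : u n - y = - (n.+1%:R^-1 *: g n).
    by rewrite /g scalerA mulVf ?pnatr_eq0// scale1r opprB.
  by rewrite norm2N norm2Z ger0_norm ?invr_ge0// mulrC ler_wpM2r ?invr_ge0.
have gB : (g n @[n --> \oo]) [set v : 'rV[R]_d | forall i, `|v 0 i - (0 : 'rV[R]_d) 0 i| <= G].
  exists 0%N => // n _ i; rewrite [X in _ - X]mxE subr0.
  exact: le_trans (coord_le_norm2 _ _) (gG n).
have [g0 [_ cg]] := box_compact 0 G (g n @[n --> \oo]) _ gB.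
exists g0 => v; case E : (f v) => [r| |]; last by have := fN v; rewrite E.
- rewrite leNgt; apply/negP => vy.
  have {}vy : ((r - dot g0 (v - y))%:E < f y)%E by rewrite EFinB lteBlDr.
  (* Semicontinuity keeps f(u_n) above r - <g0, v - y> + e; the contradiction comes from an n with
     <g_n, v - y> within e of <g0, v - y>. *)
  have [e e0 [V Vy fV]] : exists2 e : R, 0 < e & exists2 V, nbhs y V &
      forall w, V w -> ((r - dot g0 (v - y) + e)%:E < f w)%E.
    by have [e e0 ye] := lte_EFin_room _ _ vy; exists e => //; exact: lsc.
  have ge : nbhs g0 [set g' | `|dot g0 (v - y) - dot g' (v - y)| < e].
    exact: (continuous_dotl (v - y) g0 _ (nbhsx_ballx _ e e0)).
  pose B := [set g' | exists2 n, V (u n) & g' = g n].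
  have FB : (g n @[n --> \oo]) B.
    by have [k _ hk] := u_cvg _ Vy; exists k => // n /hk Vn; exists n.
  have [_ [[n Vn ->] /= gne]] := cg _ _ FB ge.
  move: (fV _ Vn) (gP n v).
  rewrite E -(fineK (subdifferential_fin_num f f_proper _ _ (gP n))).
  rewrite -EFinD lte_fin lee_fin.
  (* The correction adds |g_n|^2 / (n+1) >= 0 to the inner product, which has the favourable
     sign. *)
  have -> : v - u n = (v - y) + n.+1%:R^-1 *: g n.
    by rewrite /g scalerA mulVf ?pnatr_eq0// scale1r subrKA.
  clearbody g; rewrite (dotDr (g n)) dotZr.
  have key (A A' c F : R) : `|A - A'| < e -> 0 <= c ->
      r - A + e < F -> F + (A' + c) <= r -> False.
    by have := ler_norm (A - A'); lra.
  by apply: key gne _; rewrite mulr_ge0 ?invr_ge0 ?dotvv_ge0.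
- by rewrite leey.
Qed.

Lemma holder_fin_num y : f y \is a fin_num.
Proof.
by have [g /(subdifferential_fin_num f f_proper)] := holder_subgradient_exists y.
Qed.

Lemma holder_descent (x gx y : 'rV[R]_d) : subdifferential f x gx ->
  fine (f y) <= fine (f x) + dot gx (y - x) + beta / (1 + p) * norm2 (y - x) `^ (1 + p).
Proof.
move=> gxP; have /choice[G GP] := holder_subgradient_exists.
set v := y - x; set r := norm2 v; set W := beta / (1 + p) * r `^ (1 + p).
have r0 : 0 <= r := norm2_ge0 _.
have p1 : 0 < 1 + p by rewrite ltr_wpDr.
have W0 : 0 <= W by rewrite mulr_ge0 ?powR_ge0// divr_ge0 ?ltW.
have rp : r * r `^ p = r `^ (1 + p).
  have [->|rn0] := eqVneq r 0; first by rewrite mul0r powR0// gt_eqF.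
  by rewrite powRD ?rn0 ?implybT// powRr1.
(* The power is taken at k + 1: reaching the point k + 1 costs a multiple of ((k+1)/m)^p, and the
   tangent at (k+1)/m bounds this by the increment of t^(1+p) up to (k+2)/m. *)
have path n k : (fine (f (x + (k%:R / n.+1%:R) *: v)) <= fine (f x)
    + k%:R / n.+1%:R * dot gx v + W * (k.+1%:R / n.+1%:R) `^ (1 + p)).
  have m0 := ltr0Sn R n; set m := n.+1%:R in m0 *.
  elim: k => [|k IH].
    rewrite !mul0r scale0r !addr0 lerDl mulr_ge0// powR_ge0//.
  set yk := x + _ in IH; set yk1 := x + _.
  have yd : yk1 - yk = m^-1 *: v.
    rewrite /yk1 /yk opprD addrACA subrr add0r -scalerBl; congr (_ *: _).
    by rewrite -mulrBl -natr1 addrAC subrr add0r mul1r.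
  (* The subgradient at the new point, tested at the previous one, bounds f from above. *)
  have A := subdifferential_fine f f_proper _ _ _ _ (GP yk1) (GP yk).
  rewrite -(opprB yk1) yd dotNr dotZr in A.
  have km0 : 0 <= k.+1%:R / m by rewrite divr_ge0 ?ltW.
  have B : dot (G yk1) v <= dot gx v + beta * (k.+1%:R / m) `^ p * r `^ (1 + p).
    rewrite -lerBlDl -rp.
    have -> : dot (G yk1) v - dot gx v = dot (G yk1 - gx) v by rewrite !dotE.
    apply: le_trans (Cauchy_Schwarz _ _) _.
    have := f_holder _ _ _ _ (GP yk1) gxP.
    have -> : yk1 - x = (k.+1%:R / m) *: v by rewrite /yk1 addrAC subrr add0r.
    rewrite norm2Z ger0_norm// -/r powRM// => /(ler_wpM2r r0) /le_trans; apply.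
    by rewrite le_eqVlt; apply/orP; left; apply/eqP; ring.
  have C := @powR_tangent_ge R (k.+1%:R / m) (k.+2%:R / m) (1 + p).
  rewrite divr_gt0// ler_pM2r ?invr_gt0// ler_nat lerDl p_ge0 leqnSn in C.
  have {}C := C isT isT isT.
  have mm : k.+2%:R / m - k.+1%:R / m = m^-1.
    by rewrite -mulrBl -natrB// subSnn mul1r.
  rewrite mm addrAC subrr add0r in C.
  have := ler_wpM2l W0 C.
  have -> : W * ((k.+1%:R / m) `^ (1 + p) + (1 + p) * (k.+1%:R / m) `^ p * m^-1)
    = W * (k.+1%:R / m) `^ (1 + p) + m^-1 * (beta * (k.+1%:R / m) `^ p * r `^ (1 + p)).
    by rewrite /W; field; rewrite !gt_eqF.
  have m00 : 0 <= m^-1 by rewrite invr_ge0 ltW.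
  have := ler_wpM2l m00 B.
  have -> : k.+1%:R / m * dot gx v = k%:R / m * dot gx v + m^-1 * dot gx v.
    by rewrite -natr1; ring.
  rewrite (mulrDr m^-1) => H1 H2.
  have key (t0 t1 t2 t3 w0 w1 F0 F1 F2 : R) : F2 - t0 <= F1 -> F1 <= F0 + t1 + w0 ->
      t0 <= t2 + t3 -> w0 + t3 <= w1 -> F2 <= F0 + (t1 + t2) + w1 by lra.
  exact: key A IH H1 H2.
rewrite -subr_le0; apply: (le0_of_le_harmonic _ (3 * W)) => [|n].
  by rewrite mulr_ge0.
have := path n n.+1; rewrite divff// scale1r mul1r /v subrKC.
set m := n.+1%:R; have m0 : 0 < m := ltr0Sn _ _.
have m1 : m^-1 <= 1 by rewrite invf_le1// ler1n.
have mi0 : 0 <= m^-1 by rewrite invr_ge0 ltW.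
have -> : n.+2%:R / m = 1 + m^-1 by rewrite -natr1 mulrDl divff ?gt_eqF// mul1r.
(* The shift by one costs a factor (1 + 1/m)^(1+p) <= 1 + 3/m, which tends to 1. *)
have le3 (e : R) : 0 <= e -> e <= 1 -> (1 + e) `^ (1 + p) <= 1 + 3 * e.
  move=> e0 e1; apply: le_trans (_ : _ <= (1 + e) `^ 2%:R) _.
    by rewrite ler_powR ?lerDl//; case/andP: p_bnd => *; lra.
  by rewrite powR_mulrn ?addr_ge0//; nra.
have := ler_wpM2l W0 (le3 _ mi0 m1); rewrite -/W.
have key (i P F0 F1 t w : R) : w * P <= w * (1 + 3 * i) -> F1 <= F0 + t + w * P ->
    F1 - (F0 + t + w) <= 3 * w * i by lra.
exact: key.
Qed.

End HolderSmooth.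

(** * From Hoelder smoothness to inexact smoothness *)

Lemma powR_expR {R : realType} (x y : R) : 0 < x -> x `^ y = expR (y * ln x).
Proof. by move=> x0; rewrite /powR gt_eqF. Qed.

(* Weighted AM-GM with weights [(1 + p) / 2] and [(1 - p) / 2]; the value of
   [kappa] is the one making the constants match. *)
Lemma holder_young {R : realType} (beta p delta r q kappa : R) :
  0 < beta -> 0 <= p -> p < 1 -> 0 < delta -> 0 <= r ->
  q = (1 - p) / (1 + p) -> kappa = (q / 2) `^ q * beta `^ (2 / (1 + p)) ->
  beta / (1 + p) * r `^ (1 + p) <= kappa / delta `^ q / 2 * r ^+ 2 + delta.
Proof.
move=> beta0 p0 p1 d0 r0 qE kappaE.
have pp : 0 < 1 + p by lra.
have pm : 0 < 1 - p by lra.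
have q0 : 0 < q by rewrite qE divr_gt0.
have kappa0 : 0 < kappa by rewrite kappaE mulr_gt0// powR_gt0// divr_gt0.
have [->|rn0] := eqVneq r 0.
  by rewrite powR0 ?gt_eqF// mulr0 expr0n /= mulr0 add0r ltW.
have rgt0 : 0 < r by rewrite lt_def rn0.
(* [x] and [y] make the weighted arithmetic mean the right side; the geometric mean is the left
   side, as logarithms show. *)
pose x := kappa / delta `^ q * r ^+ 2 / (1 + p).
pose y := 2 * delta / (1 - p).
have x0 : 0 < x by rewrite !(divr_gt0, mulr_gt0) ?powR_gt0// exprn_gt0.
have y0 : 0 < y by rewrite divr_gt0// mulr_gt0.
have := @powR_amgm R x y ((1 + p) / 2) (ltW x0) (ltW y0).
have -> : 1 - (1 + p) / 2 = (1 - p) / 2 by field.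
have -> : (1 + p) / 2 * x = kappa / delta `^ q / 2 * r ^+ 2.
  by rewrite /x; field; rewrite !gt_eqF ?powR_gt0.
have -> : (1 - p) / 2 * y = delta by rewrite /y; field; rewrite gt_eqF.
have -> : x `^ ((1 + p) / 2) * y `^ ((1 - p) / 2) = beta / (1 + p) * r `^ (1 + p).
  have lnx : ln x = q * (ln (1 - p) - ln (1 + p) - ln 2) + 2 / (1 + p) * ln beta
      - q * ln delta + (ln r + ln r) - ln (1 + p).
    have di0 : 0 < (delta `^ q)^-1 by rewrite invr_gt0 powR_gt0.
    rewrite /x ln_div ?posrE ?mulr_gt0 ?di0 ?exprn_gt0//.
    rewrite expr2 !lnM ?posrE ?mulr_gt0 ?di0//.
    rewrite lnV ?posrE ?powR_gt0// kappaE lnM ?posrE ?powR_gt0 ?divr_gt0//.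
    by rewrite !ln_powR {2}qE !ln_div ?posrE ?divr_gt0.
  have lny : ln y = ln 2 + ln delta - ln (1 - p).
    by rewrite /y ln_div ?posrE ?mulr_gt0// lnM ?posrE.
  have -> : beta / (1 + p) = expR (ln beta - ln (1 + p)).
    by rewrite -ln_div ?posrE// lnK// posrE divr_gt0.
  rewrite !powR_expR// lnx lny -!expRD; congr expR; rewrite qE; field.
  by rewrite gt_eqF.
by apply; rewrite divr_ge0 ?ltW//=; lra.
Qed.

Lemma holder_kappa_gt0 {R : realType} (beta p : R) : 0 < beta -> 0 <= p <= 1 ->
  0 < ((1 - p) / (1 + p) / 2) `^ ((1 - p) / (1 + p)) * beta `^ (2 / (1 + p)).
Proof.
move=> beta0 /andP[p0 p1]; apply: mulr_gt0; last exact: powR_gt0.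
have [->|pn1] := eqVneq p 1; first by rewrite subrr !mul0r powRr0.
have pm : 0 < 1 - p by rewrite subr_gt0 lt_neqAle pn1.
by rewrite powR_gt0// !divr_gt0// ltr_wpDr.
Qed.

Lemma holder_inexactly_smooth {R : realType} {d : nat} (f : 'rV[R]_d -> \bar R)
    (xs : 'rV[R]_d) (beta p : R) :
  closed_proper_convex f -> minimizer f xs -> holder_smooth beta p f ->
  0 < beta -> 0 <= p <= 1 ->
  let q := (1 - p) / (1 + p) in
  let kappa := (q / 2) `^ q * beta `^ (2 / (1 + p)) in
  inexactly_smooth (powerL kappa q) f.
Proof.
move=> f_cvx xs_min fH beta0 p01 q kappa x y g delta gP d0 Ly.
have f_proper : Defs.proper f by case: f_cvx.
have /andP[p0 p1] := p01.
have dq0 : delta `^ q != 0.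
  apply: contra_neqN Ly => /eqP dq; rewrite /powerL dq inve0 mulry gtr0_sg ?mul1e//.
  exact: holder_kappa_gt0.
have fin := holder_fin_num f xs beta p f_cvx xs_min fH beta0 p01.
have := holder_descent f xs beta p f_cvx xs_min fH beta0 p01 x g y gP.
rewrite -{2}(fineK (fin x)) -{2}(fineK (fin y)).
rewrite /powerL inver (negPf dq0) inver pnatr_eq0 /= -!EFinM -!EFinD lee_fin => h.
apply: le_trans h _; rewrite -!addrA lerD2l lerD2l.
set r := norm2 _; have r0 : 0 <= r := norm2_ge0 _.
(* At p = 1, q = 0 and the convention 0^0 = 1 gives kappa = beta: the descent inequality is already
   the claim without delta. *)
have [pE|pn1] := eqVneq p 1.
  have -> : r `^ (1 + p) = r ^+ 2 by rewrite pE -powR_mulrn.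
  rewrite /kappa /q pE subrr !mul0r !powRr0 divr1 mul1r divff ?gt_eqF//.
  by rewrite powRr1 ?(ltW beta0)// ler_wpDr.
have {}p1 : p < 1 by rewrite lt_neqAle pn1.
apply: (holder_young beta p _ _ _ _ beta0 p0 p1 _ r0 erefl erefl).
(* Finiteness of L excludes delta = 0, as q > 0 here. *)
rewrite lt_def d0 andbT; apply: contra_neq dq0 => ->.
by rewrite powR0// gt_eqF// divr_gt0; lra.
Qed.

(** * The two rates *)

Lemma isogm_opt_tol {R : realType} (D kappa q : R) :
  0 < D -> 0 < kappa -> 0 <= q <= 1 ->
  exists eps : nat -> R, eps @ \oo --> (0 : R) /\
  forall N : nat, (1 <= N)%N ->
  let L := powerL kappa q in
  let dl := opt_tol kappa q D N in
  let bound := (D ^+ 2 / 2 + sigma L dl zero_tol N) / tau L dl zero_tol N N in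
  forall (d : nat) (f : 'rV[R]_d -> \bar R) (x0 xstar : 'rV[R]_d)
         (x z g : nat -> 'rV[R]_d),
    closed_proper_convex f -> inexactly_smooth L f ->
    minimizer f xstar -> norm2 (x0 - xstar) <= D ->
    isogm_run L dl zero_tol N f x0 x z g ->
    (f (x N) - f xstar <= bound%:E)%E /\
    bound <=
      ((q + 1) `^ ((q - 1) / (q + 1)) / q `^ (q / (q + 1)) + eps N)
      * (kappa `^ (1 / (q + 1)) * D `^ (2 / (q + 1))
         / (N.+1)%:R `^ ((2 - q) / (q + 1))).
Proof.
move=> D0 k0 q01; have /andP[q0 q1] := q01.
pose L := powerL kappa q.
(* [B] is built from D, kappa, q and N alone, so [eps] is uniform in f, x0 and the dimension. *)
pose B N := (D ^+ 2 / 2 + sigma L (opt_tol kappa q D N) zero_tol N)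
  / tau L (opt_tol kappa q D N) zero_tol N N.
have rate0 N : 0 < rate kappa q D N.
  by rewrite /rate divr_gt0 ?mulr_gt0 ?powR_gt0.
have BG : \forall N \near \oo,
    B N <= rate_const q * bound_factor q N * rate kappa q D N.
  by exists 2%N => // N /= N2; exact: bound_le.
have GC : (fun N => rate_const q * bound_factor q N) @ \oo --> rate_const q.
  by rewrite -[X in _ --> X]mulr1; apply: cvgMr; exact: bound_factor_cvg.
have [eps [eps0 epsB]] := eventual_bound_eps B _ _ _ rate0 BG GC.
exists eps; split=> // N N1 /= d f x0 xs x z g f_cvx f_smooth xs_min x0D run.
split; last by rewrite div1r; exact: epsB.
have f_proper : Defs.proper f by case: f_cvx.
have L0 delta : 0 <= delta -> (0 < L delta)%E by move=> _; exact: powerL_gt0.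
have dl0 n : 0 <= opt_tol kappa q D N n by exact: opt_tol_ge0.
have t0 : 0 < tau L (opt_tol kappa q D N) zero_tol N 0 by exact: opt_tau0_gt0.
have := isogm_rate L _ N L0 dl0 t0 f x0 xs x z g f_proper f_smooth xs_min run N1.
have [_ _ gP _] := run.
rewrite -[f (x N)](fineK (subdifferential_fin_num f f_proper _ _ (gP N (leqnn N)))).
rewrite -[f xs](fineK (minimizer_fin_num f f_proper _ xs_min)) -EFinB lee_fin.
move=> /le_trans; apply; rewrite ler_wpM2r ?invr_ge0//.
  by rewrite ltW// (tau_gt0 _ _ _ L0 dl0 t0).
by rewrite lerD2r ler_wpM2r ?invr_ge0// ler_sqr ?nnegrE ?norm2_ge0// ltW.
Qed.

(** The extra factor on the left is kappa^(1/(q+1)) / beta. For p < 1 both sides are compared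
    through logarithms. *)
Lemma holder_rate_constE {R : realType} (p q : R) :
  0 <= p <= 1 -> q = (1 - p) / (1 + p) ->
  (q + 1) `^ ((q - 1) / (q + 1)) / q `^ (q / (q + 1)) * (q / 2) `^ ((1 - p) / 2)
  = (p + 1) `^ p / 2 `^ ((p + 1) / 2).
Proof.
move=> /andP[p0 p1] qE; have pp : 0 < 1 + p by lra.
have [pE|pn1] := eqVneq p 1.
  rewrite qE pE subrr !(mul0r, add0r, sub0r, powRr0, powR1, divr1, mulr1).
  by rewrite divff ?gt_eqF// powRr1// divff// gt_eqF.
have pm : 0 < 1 - p by rewrite subr_gt0 lt_neqAle pn1.
have q0 : 0 < q by rewrite qE divr_gt0.
have qq : q + 1 = 2 / (1 + p) by rewrite qE; field; rewrite gt_eqF.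
rewrite (addrC p) !powR_expR ?divr_gt0// ?addr_gt0// -!expRN -!expRD.
congr expR; rewrite qq !ln_div ?posrE// qE ln_div ?posrE//.
by field; rewrite gt_eqF.
Qed.

Theorem theorem4p3 (R : realType) :
  (forall D kappa q : R, 0 < D -> 0 < kappa -> 0 <= q <= 1 ->
    exists eps : nat -> R, eps @ \oo --> (0 : R) /\
    forall N : nat, (1 <= N)%N ->
    let L := powerL kappa q in
    let dl := opt_tol kappa q D N in
    let bound := (D ^+ 2 / 2 + sigma L dl zero_tol N) / tau L dl zero_tol N N in
    forall (d : nat) (f : 'rV[R]_d -> \bar R) (x0 xstar : 'rV[R]_d)
           (x z g : nat -> 'rV[R]_d),
      closed_proper_convex f -> inexactly_smooth L f ->
      minimizer f xstar -> norm2 (x0 - xstar) <= D ->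
      isogm_run L dl zero_tol N f x0 x z g ->
      (f (x N) - f xstar <= bound%:E)%E /\
      bound <=
        ((q + 1) `^ ((q - 1) / (q + 1)) / q `^ (q / (q + 1)) + eps N)
        * (kappa `^ (1 / (q + 1)) * D `^ (2 / (q + 1))
           / (N.+1)%:R `^ ((2 - q) / (q + 1))))
  /\
  (forall D beta p : R, 0 < D -> 0 < beta -> 0 <= p <= 1 ->
    let q := (1 - p) / (1 + p) in
    let kappa := (q / 2) `^ q * beta `^ (2 / (1 + p)) in
    let L := powerL kappa q in
    exists (eps : nat -> R) (dl ds : nat -> nat -> R),
    eps @ \oo --> (0 : R) /\
    (forall N n, 0 <= dl N n /\ 0 <= ds N n) /\
    forall N : nat, (1 <= N)%N ->
    forall (d : nat) (f : 'rV[R]_d -> \bar R) (x0 xstar : 'rV[R]_d)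
           (x z g : nat -> 'rV[R]_d),
      closed_proper_convex f -> holder_smooth beta p f ->
      minimizer f xstar -> norm2 (x0 - xstar) <= D ->
      isogm_run L (dl N) (ds N) N f x0 x z g ->
      (f (x N) - f xstar <=
        (((p + 1) `^ p / 2 `^ ((p + 1) / 2) + eps N)
         * (beta * D `^ (1 + p) / (N.+1)%:R `^ ((1 + 3 * p) / 2)))%:E)%E).
Proof.
split; first exact: isogm_opt_tol.
move=> D beta p D0 beta0 p01 q kappa L; have /andP[p0 p1] := p01.
have pp : 0 < 1 + p by lra.
have q01 : 0 <= q <= 1.
  by rewrite divr_ge0 ?subr_ge0 ?(ltW pp)//= ler_pdivrMr// mul1r; lra.
have k0 : 0 < kappa by exact: holder_kappa_gt0.
have [eps [eps0 epsB]] := isogm_opt_tol D kappa q D0 k0 q01.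
(* kappa^(1/(q+1)) = K beta, so the error sequence of the first rate gets multiplied by [K]; the
   tolerances stay the same. *)
pose K : R := (q / 2) `^ ((1 - p) / 2).
exists (fun N => eps N * K), (opt_tol kappa q D), (fun=> zero_tol); split.
  by rewrite -(mul0r K); exact: cvgMl.
split=> [N n|N N1 d f x0 xs x z g f_cvx f_holder xs_min x0D run].
  by split=> //; apply: opt_tol_ge0.
have f_smooth := holder_inexactly_smooth f xs beta p f_cvx xs_min f_holder beta0 p01.
have [/le_trans h1 h2] := epsB N N1 d f x0 xs x z g f_cvx f_smooth xs_min x0D run.
apply: h1; rewrite lee_fin; apply: le_trans h2 _.
have qq : q + 1 = 2 / (1 + p) by rewrite /q; field; rewrite gt_eqF.
have q2 : 0 <= q / 2 by case/andP: q01 => q_ge0 _; rewrite divr_ge0.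
have -> : kappa `^ (1 / (q + 1)) = K * beta.
  rewrite /kappa powRM ?powR_ge0// -!powRrM; congr (_ * _).
    by congr (_ `^ _); rewrite qq /q; field; rewrite gt_eqF.
  rewrite (_ : _ * _ = 1) ?powRr1 ?(ltW beta0)// qq.
  by field; rewrite gt_eqF.
have -> : 2 / (q + 1) = 1 + p by rewrite qq; field; rewrite gt_eqF.
have -> : (2 - q) / (q + 1) = (1 + 3 * p) / 2.
  by rewrite qq /q; field; rewrite gt_eqF.
rewrite -(holder_rate_constE p q p01 erefl) -/K -mulrDl -!mulrA le_eqVlt.
by rewrite !mulrA eqxx.
Qed.
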